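(* Let $A$ be a unital associative superalgebra over $\mathbb{K}$, also regarded as a Lie superalgebra with bracket $[a,b]=ab-(-1)^{|a||b|}ba$. Then there is an exact sequence of supermodules $$\frac{A}{[A,A]}\otimes_{\mathbb{K}}HC_1(A)\to\mathcal{H}_1(A,V(A))\to\mathcal{H}_1(A,[A,A])\to HC_1(A)\to HC_1^M(A)\to\frac{[A,A]}{[A,[A,A]]}\to0.$$
   Context: $\mathbb{K}$ is a unital commutative ring. A supermodule is a $\mathbb{K}$-module $M=M_{\bar0}\oplus M_{\bar1}$ graded by $\mathbb{Z}_2$; $|m|$ is the degree of a homogeneous element, and elements occurring in formulas with degrees are homogeneous. A superalgebra is a supermodule with a bilinear multiplication compatible with the grading. A Lie superalgebra is a supermodule $M$ with a bilinear bracket, $[M_{\alpha},M_{\beta}]\subseteq M_{\alpha+\beta}$, such that $[x,y]=-(-1)^{|x||y|}[y,x]$ and $[x,[y,z]]=[[x,y],z]+(-1)^{|x||y|}[y,[x,z]]$ for homogeneous $x,y,z$, and $[x,x]=0$ for $x\in M_{\bar0}$. $[M,N]$ denotes the submodule spanned by the brackets $[m,n]$. An action of a Lie superalgebra $P$ on a Lie superalgebra $M$ is an even (degree-preserving) bilinear map $P\times M\to M$, $(p,m)\mapsto{}^pm$, with ${}^{[p,p']}m={}^p({}^{p'}m)-(-1)^{|p||p'|}\,{}^{p'}({}^pm)$ and ${}^p[m,m']=[{}^pm,m']+(-1)^{|p||m|}[m,{}^pm']$. A crossed $P$-module $(M,\partial)$ is a Lie superalgebra homomorphism $\partial\colon M\to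 P$ with an action of $P$ on $M$ such that $\partial({}^pm)=[p,\partial(m)]$ and ${}^{\partial(m)}m'=[m,m']$. Non-abelian tensor product: for Lie superalgebras $M,N$ acting on each other, $M\otimes N$ is the Lie superalgebra generated by symbols $m\otimes n$ ($m\in M_{\bar0}\cup M_{\bar1}$, $n\in N_{\bar0}\cup N_{\bar1}$), of degree $|m|+|n|$, subject to: (i) $\lambda(m\otimes n)=\lambda m\otimes n=m\otimes\lambda n$ for $\lambda\in\mathbb{K}$; (ii) $(m+m')\otimes n=m\otimes n+m'\otimes n$ and $m\otimes(n+n')=m\otimes n+m\otimes n'$ for $m,m'$ (resp. $n,n'$) of the same degree; (iii) $[m,m']\otimes n=m\otimes{}^{m'}n-(-1)^{|m||m'|}(m'\otimes{}^mn)$ and $m\otimes[n,n']=(-1)^{|n'|(|m|+|n|)}({}^{n'}m\otimes n)-(-1)^{|m||n|}({}^nm\otimes n')$; (iv) $[m\otimes n,m'\otimes n']=-(-1)^{|m||n|}({}^nm\otimes{}^{m'}n')$. For a crossed $P$-module $(M,\partial)$, $P$ and $M$ act on each other by the given action of $P$ on $M$ and by ${}^mp=[\partial(m),p]$; put $\nu\colon P\otimes M\to M$, $p\otimes m\mapsto{}^pm$, and define $\mathcal{H}_0(P,M)=\operatorname{Coker}\nu$, $\mathcal{H}_1(P,M)=\operatorname{Ker}\nu$. For an associative superalgebra $A$: $V(A)=(A\otimes_{\mathbb{K}}A)/I(A)$, where $I(A)$ is the graded submodule generated by $a\otimes b+(-1)^{|a||b|}b\otimes a$ and $ab\otimes c-a\otimes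 bc+(-1)^{|c|(|a|+|b|)}ca\otimes b$ for homogeneous $a,b,c\in A$; it is a Lie superalgebra with $[a\otimes b,a'\otimes b']=[a,b]\otimes[a',b']$. It is a crossed $A$-module via $\mu\colon V(A)\to A$, $x\otimes y\mapsto[x,y]$, and the action ${}^a(x\otimes y)=[a,x]\otimes y+(-1)^{|a||x|}x\otimes[a,y]=a\otimes[x,y]$. $[A,A]$ is a crossed $A$-module via the inclusion into $A$ and the bracket action. $HC_1(A)$ is the first cyclic homology of $A$, i.e. the kernel of $V(A)\to[A,A]$, $a\otimes b\mapsto ab-(-1)^{|a||b|}ba$. The first Milnor cyclic homology $HC_1^M(A)$ is the quotient of the supermodule $A\otimes_{\mathbb{K}}A$ by the graded submodule generated by $a\otimes b+(-1)^{|a||b|}b\otimes a$, $ab\otimes c-a\otimes bc+(-1)^{|c|(|a|+|b|)}ca\otimes b$, and $a\otimes bc-(-1)^{|b||c|}a\otimes cb$ for homogeneous $a,b,c\in A$. *)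

(* Defs.v *)
From HB Require Import structures.
From mathcomp Require Import all_boot all_order all_algebra.
From mathcomp Require Import generic_quotient ring_quotient.
From mathcomp Require Import boolp classical_sets functions cardinality fsbigop.

Set Implicit Arguments.
Unset Strict Implicit.
Unset Printing Implicit Defensive.

Import GRing.Theory.
Local Open Scope ring_scope.
Local Open Scope quotient_scope.


Inductive zexp := ZVar of nat | ZZero | ZAdd of zexp & zexp | ZOpp of zexp.

Fixpoint zeval (V : zmodType) (e : seq V) t : V :=
  match t with
  | ZVar n => e`_n
  | ZZero => 0
  | ZAdd a b => zeval e a + zeval e b
  | ZOpp a => - zeval e a
  end.

Fixpoint zcoef t (n : nat) : int :=
  match t with
  | ZVar m => if m == n then 1 else 0
  | ZZero => 0
  | ZAdd a b => zcoef a n + zcoef b n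
  | ZOpp a => - zcoef a n
  end.

Lemma zevalE (V : zmodType) (e : seq V) t :
  zeval e t = \sum_(i < size e) e`_i *~ zcoef t i.
Proof.
elim: t => /= [n||a -> b ->|a ->].
- case: (ltnP n (size e)) => [lt_n|le_n].
    rewrite (bigD1 (Ordinal lt_n)) //= eqxx mulr1z big1 ?addr0 // => i ni.
    case: eqP => [E|_]; last exact: mulr0z.
    by case/eqP: ni; apply: val_inj.
  rewrite nth_default // big1 // => i _; case: eqP => [E|_]; last exact: mulr0z.
  by move: (ltn_ord i); rewrite -E ltnNge le_n.
- by rewrite big1 // => i _; exact: mulr0z.
- by rewrite -big_split; apply: eq_bigr => i _; rewrite mulrzDr.
- by rewrite -sumrN; apply: eq_bigr => i _; rewrite mulrNz.
Qed.

Lemma zeq_by_coef (V : zmodType) (e : seq V) t u :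
  all (fun i => zcoef t i == zcoef u i) (iota 0 (size e)) ->
  zeval e t = zeval e u.
Proof.
move=> /allP H; rewrite !zevalE; apply: eq_bigr => i _.
by rewrite (eqP (H i _)) // mem_iota /= ltn_ord.
Qed.


Ltac zpush x e :=
  match e with
  | context [ x :: _ ] => e
  | _ => constr:(x :: e)
  end.

Ltac zatoms t e :=
  lazymatch t with
  | 0 => e
  | ?a + ?b => let e' := zatoms a e in zatoms b e'
  | - ?a => zatoms a e
  | ?x => zpush x e
  end.

Ltac zidx x e :=
  lazymatch e with
  | x :: _ => constr:(0%N)
  | _ :: ?e' => let n := zidx x e' in constr:(n.+1)
  end.

Ltac zquote t e :=
  lazymatch t with
  | 0 => constr:(ZZero)
  | ?a + ?b =>
    let a' := zquote a e in let b' := zquote b e in constr:(ZAdd a' b')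
  | - ?a => let a' := zquote a e in constr:(ZOpp a')
  | ?x => let n := zidx x e in constr:(ZVar n)
  end.

Ltac abel :=
  lazymatch goal with
  | |- @eq ?V ?t ?u =>
    let e := zatoms t (@nil V) in
    let e := zatoms u e in
    let t' := zquote t e in
    let u' := zquote u e in
    refine (@zeq_by_coef V e t' u' _); vm_cast_no_check (erefl true)
  end.


Section Modules.
Variable K : comPzRingType.
Implicit Types M N P : lmodType K.

Definition bilinear_map M N P (f : M -> N -> P) :=
  (forall n, linear (f^~ n)) /\ (forall m, linear (f m)).

Section BilinearTheory.
Variables (M N P : lmodType K) (f : M -> N -> P) (fB : bilinear_map f).

Lemma bilDl x y n : f (x + y) n = f x n + f y n.
Proof. by have := fB.1 n 1 x y; rewrite !scale1r. Qed.
Lemma bilDr m x y : f m (x + y) = f m x + f m y.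
Proof. by have := fB.2 m 1 x y; rewrite !scale1r. Qed.
Lemma bil0l n : f 0 n = 0.
Proof. by apply: (addrI (f 0 n)); rewrite -bilDl !addr0. Qed.
Lemma bil0r m : f m 0 = 0.
Proof. by apply: (addrI (f m 0)); rewrite -bilDr !addr0. Qed.
Lemma bilZl a x n : f (a *: x) n = a *: f x n.
Proof. by have := fB.1 n a x 0; rewrite !addr0 bil0l addr0. Qed.
Lemma bilZr a m x : f m (a *: x) = a *: f m x.
Proof. by have := fB.2 m a x 0; rewrite !addr0 bil0r addr0. Qed.
Lemma bilNl x n : f (- x) n = - f x n.
Proof. by rewrite -scaleN1r bilZl scaleN1r. Qed.
Lemma bilNr m x : f m (- x) = - f m x.
Proof. by rewrite -scaleN1r bilZr scaleN1r. Qed.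
Lemma bilBl x y n : f (x - y) n = f x n - f y n.
Proof. by rewrite bilDl bilNl. Qed.
Lemma bilBr m x y : f m (x - y) = f m x - f m y.
Proof. by rewrite bilDr bilNr. Qed.
End BilinearTheory.

Section Submodule.
Variables (M : lmodType K) (S : submodClosed M).

Lemma submodN x : x \in S -> - x \in S.
Proof. by move=> Sx; rewrite -scaleN1r rpredZ. Qed.
Lemma submodB x y : x \in S -> y \in S -> x - y \in S.
Proof. by move=> Sx Sy; rewrite rpredD ?submodN. Qed.

Definition submodule := {x : M | x \in S}.
HB.instance Definition _ := SubChoice.on submodule.
HB.instance Definition _ := [SubChoice_isSubLmodule of submodule by <:].
End Submodule.

Section QuotientModule.
Variables (M : lmodType K) (S : submodClosed M).

Definition qker : {pred M} := S.
Lemma qker_subproof : zmod_closed qker.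
Proof. by split=> [|x y]; [exact: rpred0 | exact: submodB]. Qed.
HB.instance Definition _ := GRing.isZmodClosed.Build M qker qker_subproof.

Definition quotient := Quotient.quot qker.
HB.instance Definition _ := GRing.Zmodule.on quotient.

Definition qpi (x : M) : quotient := \pi_(Quotient.quot qker) x.

Lemma qpi_eq x y : (qpi x = qpi y) <-> (x - y \in S).
Proof.
rewrite -[x - y \in S]/(x - y \in qker) Quotient.idealrBE.
by split=> /eqP.
Qed.

Lemma qpi_zmod : zmod_morphism qpi.
Proof. by move=> x y; rewrite /qpi !piE. Qed.

Lemma qpi_surj q : exists x, qpi x = q.
Proof. by exists (repr q); rewrite /qpi reprK. Qed.

HB.instance Definition _ := GRing.isZmodMorphism.Build M quotient qpi qpi_zmod.

Lemma qpi0 x : (qpi x = 0) <-> (x \in S).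
Proof. by rewrite -(raddf0 qpi) qpi_eq subr0. Qed.

Definition qscale a (q : quotient) : quotient := qpi (a *: repr q).

Lemma qscale_pi a x : qscale a (qpi x) = qpi (a *: x).
Proof.
by apply/qpi_eq; rewrite -scalerBr rpredZ //; apply/qpi_eq; rewrite /qpi reprK.
Qed.

Lemma qscaleA a b q : qscale a (qscale b q) = qscale (a * b) q.
Proof. by have [x <-] := qpi_surj q; rewrite !qscale_pi scalerA. Qed.
Lemma qscale1 : left_id 1 qscale.
Proof. by move=> q; have [x <-] := qpi_surj q; rewrite !qscale_pi scale1r. Qed.
Lemma qscaleDr : right_distributive qscale +%R.
Proof.
move=> a q r; have [x <-] := qpi_surj q; have [y <-] := qpi_surj r.
by rewrite -raddfD !qscale_pi scalerDr raddfD.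
Qed.
Lemma qscaleDl q : {morph qscale^~ q : a b / a + b}.
Proof.
by move=> a b; have [x <-] := qpi_surj q; rewrite !qscale_pi scalerDl raddfD.
Qed.

HB.instance Definition _ :=
  GRing.Zmodule_isLmodule.Build K quotient qscaleA qscale1 qscaleDr qscaleDl.

Lemma qpi_scale : scalable qpi.
Proof. by move=> a x; rewrite -qscale_pi. Qed.
HB.instance Definition _ := GRing.isScalable.Build K M quotient *:%R qpi qpi_scale.

Section Lift.
Variables (N : lmodType K) (f : {linear M -> N}).
Hypothesis fS : forall x, x \in S -> f x = 0.

Definition qlift (q : quotient) : N := f (repr q).

Lemma qlift_pi x : qlift (qpi x) = f x.
Proof.
apply/eqP; rewrite -subr_eq0 -raddfB; apply/eqP/fS/qpi_eq.
by rewrite /qpi reprK.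
Qed.

Lemma qlift_linear : linear qlift.
Proof.
move=> a q r; have [x <-] := qpi_surj q; have [y <-] := qpi_surj r.
by rewrite -linearP !qlift_pi linearP.
Qed.
HB.instance Definition _ :=
  GRing.isLinear.Build K quotient N *:%R qlift qlift_linear.
End Lift.
End QuotientModule.

Section Span.
Variables (M : lmodType K) (G : M -> Prop).

Inductive spanned : M -> Prop :=
| spanned0 : spanned 0
| spanned_gen x : G x -> spanned x
| spanned_lin a x y : spanned x -> spanned y -> spanned (a *: x + y).

Definition span : {pred M} := fun x => `[< spanned x >].

Lemma span_subproof : submod_closed span.
Proof.
split; first by apply/asboolP; exact: spanned0.
by move=> a x y /asboolP sx /asboolP sy; apply/asboolP; exact: spanned_lin.
Qed.
HB.instance Definition _ := GRing.isSubmodClosed.Build K M span span_subproof.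

Lemma span_gen x : G x -> x \in span.
Proof. by move=> Gx; apply/asboolP; exact: spanned_gen. Qed.

Lemma span_ind (P : M -> Prop) :
  P 0 -> (forall x, G x -> P x) ->
  (forall a x y, x \in span -> y \in span -> P x -> P y -> P (a *: x + y)) ->
  forall x, x \in span -> P x.
Proof.
move=> P0 PG PL x /asboolP; elim=> {x} // a x y sx Px sy Py.
by apply: PL => //; apply/asboolP.
Qed.

Lemma span_sub (S : submodClosed M) :
  (forall x, G x -> x \in S) -> forall x, x \in span -> x \in S.
Proof.
move=> GS; apply: span_ind => //; first exact: rpred0.
by move=> a x y _ _ Sx Sy; rewrite rpredD // rpredZ.
Qed.
End Span.

Section FreeModule.
Variable X : choiceType.

Definition finsupp : {pred X -> K^o} :=
  fun f => `[< finite_set [set x | f x != 0] >].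

Lemma finsupp_subproof : submod_closed finsupp.
Proof.
split.
  apply/asboolP; rewrite (_ : mkset _ = set0) ?finite_set0 //.
  by apply/seteqP; split=> x //=; rewrite eqxx.
move=> a f g /asboolP ff /asboolP fg; apply/asboolP.
apply: (@sub_finite_set _ _ ([set x | f x != 0] `|` [set x | g x != 0])%classic).
  move=> x /=; case: (eqVneq (f x) 0) => [fx|]; last by left.
  case: (eqVneq (g x) 0) => [gx|]; last by right.
  by rewrite -[(_ + _) x]/(a *: f x + g x) fx gx scaler0 addr0 eqxx.
by rewrite finite_setU.
Qed.
HB.instance Definition _ :=
  GRing.isSubmodClosed.Build K (X -> K^o) finsupp finsupp_subproof.

Definition freemod := submodule finsupp.
HB.instance Definition _ := GRing.Lmodule.on freemod.

Definition fcoef (f : freemod) (x : X) : K := val f x.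

Lemma freemodP (f g : freemod) : fcoef f =1 fcoef g -> f = g.
Proof. by move=> E; apply/val_inj/funext. Qed.

Lemma fcoef_fin (f : freemod) : finite_set [set x | fcoef f x != 0].
Proof. by have /asboolP := valP f. Qed.

Lemma fcoefP a (f g : freemod) x :
  fcoef (a *: f + g) x = a * fcoef f x + fcoef g x.
Proof. by []. Qed.
Lemma fcoef0 x : fcoef 0 x = 0. Proof. by []. Qed.
Lemma fcoefD (f g : freemod) x : fcoef (f + g) x = fcoef f x + fcoef g x.
Proof. by []. Qed.
Lemma fcoefZ a (f : freemod) x : fcoef (a *: f) x = a * fcoef f x.
Proof. by []. Qed.

Definition mkfree_subproof (f : X -> K^o) :
  finite_set [set x | f x != 0] -> f \in finsupp.
Proof. by move=> ff; apply/asboolP. Qed.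
Definition mkfree (f : X -> K^o) (ff : finite_set [set x | f x != 0]) : freemod :=
  exist (fun g => g \in finsupp) f (mkfree_subproof ff).

Lemma fdelta_subproof (x : X) :
  finite_set [set y | ((y == x)%:R : K^o) != 0].
Proof.
apply: (@sub_finite_set _ _ [set x]%classic); last exact: finite_set1.
by move=> y /=; case: (eqVneq y x) => // _; rewrite mulr0n eqxx.
Qed.
Definition fdelta (x : X) : freemod := mkfree (@fdelta_subproof x).

Lemma fcoef_delta x y : fcoef (fdelta x) y = (y == x)%:R.
Proof. by []. Qed.

Lemma fcoef_sum I (r : seq I) (F : I -> freemod) y :
  fcoef (\sum_(i <- r) F i) y = \sum_(i <- r) fcoef (F i) y.
Proof.
by elim: r => [|i r IH]; rewrite ?big_nil ?big_cons ?fcoef0 // fcoefD IH.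
Qed.

Lemma freemod_expand (f : freemod) (r : seq X) : uniq r ->
  (forall x, x \notin r -> fcoef f x = 0) ->
  f = \sum_(x <- r) fcoef f x *: fdelta x.
Proof.
move=> ur fr; apply: freemodP => y; rewrite fcoef_sum.
under eq_bigr do rewrite fcoefZ fcoef_delta.
case: (boolP (y \in r)) => [yr|yr].
  rewrite (bigD1_seq y) //= eqxx mulr1 big1 ?addr0 // => x /negPf xy.
  by rewrite eq_sym xy mulr0.
rewrite fr // big_seq big1 // => x xr; case: eqP => [E|_]; last by rewrite mulr0.
by rewrite E xr in yr.
Qed.

Lemma freemod_supp (f : freemod) :
  exists2 r : seq X, uniq r & forall x, x \notin r -> fcoef f x = 0.
Proof.
have /finite_seqP [r fr] := fcoef_fin f.
exists (undup r) => [|x]; first exact: undup_uniq.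
rewrite mem_undup => xr; apply/eqP/negPn/negP => fx.
have : [set y | fcoef f y != 0]%classic x by [].
by rewrite fr /= (negPf xr).
Qed.

Lemma freemod_ind (P : freemod -> Prop) :
  P 0 -> (forall a x f, P f -> P (a *: fdelta x + f)) -> forall f, P f.
Proof.
move=> P0 PS f; have [r ur fr] := freemod_supp f.
rewrite (freemod_expand ur fr); elim: {ur fr} r => [|x r IH].
  by rewrite big_nil.
by rewrite big_cons; apply: PS.
Qed.

Section Lift.
Variables (N : lmodType K) (phi : X -> N).

Definition flift (f : freemod) : N := \sum_(x \in [set: X]) fcoef f x *: phi x.

Lemma fliftE (f : freemod) (r : seq X) : uniq r ->
  (forall x, x \notin r -> fcoef f x = 0) ->
  flift f = \sum_(x <- r) fcoef f x *: phi x.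
Proof.
move=> ur fr; rewrite /flift (fsbigE r) //; last first.
  by move=> x _ /fr ->; rewrite scale0r.
by apply: eq_bigl => x; rewrite in_setT.
Qed.

Lemma flift_linear : linear flift.
Proof.
move=> a f g; have [r _ fr] := freemod_supp f; have [s _ gs] := freemod_supp g.
have ut : uniq (undup (r ++ s)) by exact: undup_uniq.
have ft x : x \notin undup (r ++ s) -> fcoef f x = 0.
  by rewrite mem_undup mem_cat negb_or => /andP [/fr].
have gt x : x \notin undup (r ++ s) -> fcoef g x = 0.
  by rewrite mem_undup mem_cat negb_or => /andP [_ /gs].
rewrite (fliftE ut ft) (fliftE ut gt) (fliftE ut); last first.
  by move=> x xt; rewrite fcoefP ft // gt // mulr0 addr0.
rewrite scaler_sumr -big_split; apply: eq_bigr => x _ /=.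
by rewrite fcoefP scalerDl scalerA.
Qed.
HB.instance Definition _ :=
  GRing.isLinear.Build K freemod N *:%R flift flift_linear.

Lemma fliftD f g : flift (f + g) = flift f + flift g.
Proof. exact: raddfD. Qed.
Lemma fliftB f g : flift (f - g) = flift f - flift g.
Proof. exact: raddfB. Qed.
Lemma fliftZ a f : flift (a *: f) = a *: flift f.
Proof. exact: linearZ. Qed.

Lemma flift_delta x : flift (fdelta x) = phi x.
Proof.
rewrite (@fliftE _ [:: x]) // ?big_seq1 ?fcoef_delta ?eqxx ?scale1r // => y.
by rewrite inE fcoef_delta => /negPf ->.
Qed.
End Lift.
End FreeModule.
End Modules.

Arguments fdelta {K X} x.

(* Degrees in Z/2 are booleans, so degrees add by [addb] and the sign
   (-1)^(|x||y|) is [(-1) ^+ (i && j)]. [gr M i] is the component of degree [i]. *)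
Record supermodule (K : comPzRingType) := Supermodule {
  super_mod :> lmodType K;
  gr : bool -> submodClosed super_mod;
  gr_dec : forall x : super_mod,
    exists x0 x1, [/\ x0 \in gr false, x1 \in gr true & x = x0 + x1];
  gr_cap : forall x : super_mod, x \in gr false -> x \in gr true -> x = 0
}.
Arguments gr {K} M i : rename.

Section Super.
Variable K : comPzRingType.

Record superhom (M N : supermodule K) := Superhom {
  sh_fun :> {linear M -> N};
  sh_even : forall i x, x \in gr M i -> sh_fun x \in gr N i
}.

Section SuperhomTheory.
Variables (M N : supermodule K) (f : superhom M N).
Lemma shD x y : f (x + y) = f x + f y. Proof. exact: raddfD. Qed.
Lemma shB x y : f (x - y) = f x - f y. Proof. exact: raddfB. Qed.
Lemma shN x : f (- x) = - f x. Proof. exact: raddfN. Qed.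
Lemma shZ a x : f (a *: x) = a *: f x. Proof. exact: linearZ. Qed.
Lemma sh0 : f 0 = 0. Proof. exact: raddf0. Qed.
End SuperhomTheory.

Section Components.
Variable M : supermodule K.

Lemma comp_ex (x : M) : exists p : M * M,
  [/\ p.1 \in gr M false, p.2 \in gr M true & x = p.1 + p.2].
Proof. by have [x0 [x1 H]] := gr_dec x; exists (x0, x1). Qed.

Definition comp (i : bool) (x : M) : M :=
  let p := sval (cid (comp_ex x)) in if i then p.2 else p.1.

Lemma comp_in i x : comp i x \in gr M i.
Proof. by rewrite /comp; case: cid => p [] /=; case: i. Qed.

Lemma comp_sum x : x = comp false x + comp true x.
Proof. by rewrite {1}/comp /comp; case: cid => p []. Qed.

Lemma gr_uniq x0 x1 y0 y1 : x0 \in gr M false -> x1 \in gr M true ->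
  y0 \in gr M false -> y1 \in gr M true -> x0 + x1 = y0 + y1 ->
  x0 = y0 /\ x1 = y1.
Proof.
move=> x0P x1P y0P y1P E.
have D : x0 - y0 = y1 - x1.
  by apply/eqP; rewrite subr_eq addrAC eq_sym subr_eq [y1 + _]addrC -E.
have Z : x0 - y0 = 0.
  by apply: gr_cap; [|rewrite D]; exact: submodB.
by split; apply/eqP; [rewrite -subr_eq0 Z | rewrite eq_sym -subr_eq0 -D Z].
Qed.

Lemma comp_eq i x x0 x1 : x0 \in gr M false -> x1 \in gr M true ->
  x = x0 + x1 -> comp i x = if i then x1 else x0.
Proof.
move=> x0P x1P E; have := comp_sum x; rewrite {1}E => {}E.
have [] := gr_uniq x0P x1P (comp_in false x) (comp_in true x) E.
by case: i => ? ?.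
Qed.

Lemma comp_linear i : linear (comp i).
Proof.
move=> a x y.
rewrite (@comp_eq i (a *: x + y) (a *: comp false x + comp false y)
  (a *: comp true x + comp true y)) ?rpredD ?rpredZ ?comp_in //; first by case: i.
by rewrite {1}(comp_sum x) {1}(comp_sum y) scalerDr addrACA.
Qed.
HB.instance Definition _ i :=
  GRing.isLinear.Build K M M *:%R (comp i) (comp_linear i).

Lemma compD i x y : comp i (x + y) = comp i x + comp i y.
Proof. exact: raddfD. Qed.
Lemma compB i x y : comp i (x - y) = comp i x - comp i y.
Proof. exact: raddfB. Qed.
Lemma compZ i a x : comp i (a *: x) = a *: comp i x.
Proof. exact: linearZ. Qed.
Lemma comp0 i : comp i 0 = 0.
Proof. exact: raddf0. Qed.

Lemma comp_id i j x : x \in gr M i -> comp j x = if j == i then x else 0.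
Proof.
case: i => xP.
  by rewrite (@comp_eq j x 0 x) ?rpred0 ?add0r //; case: j.
by rewrite (@comp_eq j x x 0) ?rpred0 ?addr0 //; case: j.
Qed.
End Components.
Arguments comp {M} i x : simpl never.

Lemma comp_hom (M N : supermodule K) (f : superhom M N) i x :
  comp i (f x) = f (comp i x).
Proof.
rewrite (@comp_eq _ i (f x) (f (comp false x)) (f (comp true x))).
- by case: i.
- exact/sh_even/comp_in.
- exact/sh_even/comp_in.
- by rewrite -raddfD -comp_sum.
Qed.

(* Graded submodules. *)
Record gsub (M : supermodule K) := GSub {
  gsub_set :> submodClosed M;
  gsubP : forall i x, x \in gsub_set -> comp i x \in gsub_set
}.

Section SubSuper.
Variables (M : supermodule K) (S : gsub M).

Definition sub_gr (i : bool) : {pred submodule S} := fun x => val x \in gr M i.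
Lemma sub_gr_subproof i : submod_closed (sub_gr i).
Proof.
split=> [|a x y xP yP]; first exact: (rpred0 (gr M i)).
by rewrite -[_ \in _]/(a *: val x + val y \in gr M i) rpredD ?rpredZ.
Qed.
HB.instance Definition _ i :=
  GRing.isSubmodClosed.Build K (submodule S) (sub_gr i) (sub_gr_subproof i).

Lemma sub_gr_dec (x : submodule S) : exists x0 x1,
  [/\ x0 \in sub_gr false, x1 \in sub_gr true & x = x0 + x1].
Proof.
exists (exist (fun y => y \in S) _ (gsubP false (valP x))).
exists (exist (fun y => y \in S) _ (gsubP true (valP x))).
by split; [exact: comp_in | exact: comp_in | apply/val_inj/comp_sum].
Qed.
Lemma sub_gr_cap (x : submodule S) :
  x \in sub_gr false -> x \in sub_gr true -> x = 0.
Proof. by move=> x0 x1; apply/val_inj; exact: gr_cap. Qed.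

Definition sub_super : supermodule K := Supermodule sub_gr_dec sub_gr_cap.

Definition sub_val (x : sub_super) : M := val x.
Lemma sub_val_linear : linear sub_val.
Proof. by []. Qed.
HB.instance Definition _ :=
  GRing.isLinear.Build K sub_super M *:%R sub_val sub_val_linear.
Definition sub_incl : superhom sub_super M :=
  @Superhom sub_super M sub_val (fun _ _ H => H).

Lemma sub_valP (x : sub_super) : sub_val x \in S.
Proof. exact: valP. Qed.
Lemma sub_val_inj : injective sub_val.
Proof. exact: val_inj. Qed.

Section Corestriction.
Variables (N : supermodule K) (f : superhom N M).
Hypothesis fS : forall x, f x \in S.
Definition corestr_fun (x : N) : sub_super :=
  exist (fun y => y \in S) (f x) (fS x).
Lemma corestr_linear : linear corestr_fun.
Proof. by move=> a x y; apply: sub_val_inj; rewrite /sub_val /= linearP. Qed.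
HB.instance Definition _ :=
  GRing.isLinear.Build K N sub_super *:%R corestr_fun corestr_linear.
Lemma corestr_even i x : x \in gr N i -> corestr_fun x \in gr sub_super i.
Proof. exact: (@sh_even _ _ f). Qed.
Definition corestr : superhom N sub_super := Superhom corestr_even.
End Corestriction.
End SubSuper.

Section QuotSuper.
Variables (M : supermodule K) (S : gsub M).

Definition quot_gr (i : bool) : {pred quotient S} :=
  fun q => `[< exists2 x, x \in gr M i & qpi S x = q >].
Lemma quot_gr_subproof i : submod_closed (quot_gr i).
Proof.
split; first by apply/asboolP; exists 0; rewrite ?rpred0 ?raddf0.
move=> a q r /asboolP [x xi <-] /asboolP [y yi <-]; apply/asboolP.
by exists (a *: x + y); rewrite ?rpredD ?rpredZ // linearP.
Qed.
HB.instance Definition _ i :=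
  GRing.isSubmodClosed.Build K (quotient S) (quot_gr i) (quot_gr_subproof i).

Lemma quot_gr_pi i x : x \in gr M i -> qpi S x \in quot_gr i.
Proof. by move=> xi; apply/asboolP; exists x. Qed.

Lemma quot_gr_dec (q : quotient S) : exists q0 q1,
  [/\ q0 \in quot_gr false, q1 \in quot_gr true & q = q0 + q1].
Proof.
have [x <-] := qpi_surj q; exists (qpi S (comp false x)), (qpi S (comp true x)).
by rewrite -raddfD -comp_sum; split=> //; apply/quot_gr_pi/comp_in.
Qed.
Lemma quot_gr_cap (q : quotient S) :
  q \in quot_gr false -> q \in quot_gr true -> q = 0.
Proof.
move=> /asboolP [x x0 <-] /asboolP [y y1 /qpi_eq /(gsubP false)].
rewrite compB (comp_id _ x0) (comp_id _ y1) /= sub0r => xS.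
by apply/qpi0; rewrite -[x]opprK; exact: submodN.
Qed.

Definition quot_super : supermodule K := Supermodule quot_gr_dec quot_gr_cap.

Definition sqpi_fun (x : M) : quot_super := qpi S x.
Lemma sqpi_linear : linear sqpi_fun.
Proof. exact: linearP. Qed.
HB.instance Definition _ :=
  GRing.isLinear.Build K M quot_super *:%R sqpi_fun sqpi_linear.
Definition sqpi : superhom M quot_super := @Superhom M quot_super sqpi_fun quot_gr_pi.

Lemma sqpi_surj (q : quot_super) : exists x, sqpi x = q.
Proof. exact: qpi_surj. Qed.
Lemma sqpi_surj_gr i (q : quot_super) : q \in gr quot_super i ->
  exists2 x, x \in gr M i & sqpi x = q.
Proof. by move=> /asboolP. Qed.
Lemma sqpi_eq x y : (sqpi x = sqpi y) <-> (x - y \in S).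
Proof. exact: qpi_eq. Qed.
Lemma sqpi0 x : (sqpi x = 0) <-> (x \in S).
Proof. exact: qpi0. Qed.

Section Lift.
Variables (N : supermodule K) (f : superhom M N).
Hypothesis fS : forall x, x \in S -> f x = 0.
Definition sqlift_fun (q : quot_super) : N := qlift f q.
Lemma sqlift_pi x : sqlift_fun (sqpi x) = f x.
Proof. exact: qlift_pi. Qed.
Lemma sqlift_linear : linear sqlift_fun.
Proof.
move=> a q r; have [x <-] := sqpi_surj q; have [y <-] := sqpi_surj r.
by rewrite -linearP !sqlift_pi linearP.
Qed.
HB.instance Definition _ :=
  GRing.isLinear.Build K quot_super N *:%R sqlift_fun sqlift_linear.
Lemma sqlift_even i q : q \in gr quot_super i -> sqlift_fun q \in gr N i.
Proof. by move=> /sqpi_surj_gr [x xi <-]; rewrite sqlift_pi sh_even. Qed.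
Definition sqlift : superhom quot_super N := Superhom sqlift_even.
Lemma sqliftE x : sqlift (sqpi x) = f x.
Proof. exact: sqlift_pi. Qed.
End Lift.
End QuotSuper.

Section GradedSpan.
Variables (M : supermodule K) (G : M -> Prop).
Hypothesis Gcomp : forall i x, G x -> comp i x \in span G.

Lemma span_comp i x : x \in span G -> comp i x \in span G.
Proof.
move: x; apply: span_ind => [|x|a x y _ _ sx sy].
- by rewrite comp0 rpred0.
- exact: Gcomp.
- by rewrite compD compZ rpredD ?rpredZ.
Qed.
Definition gspan : gsub M := GSub span_comp.
End GradedSpan.

Lemma homog_gspan (M : supermodule K) (G : M -> Prop) :
  (forall x, G x -> exists i, x \in gr M i) ->
  forall i x, G x -> comp i x \in span G.
Proof.
move=> GH i x Gx; have [k xk] := GH _ Gx; rewrite (comp_id _ xk).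
by case: eqP => _; [exact: span_gen | exact: rpred0].
Qed.

Section Preimage.
Variables (M N : supermodule K) (f : superhom M N) (S : gsub N).
Definition preim_pred : {pred M} := fun x => f x \in S.
Lemma preim_subproof : submod_closed preim_pred.
Proof.
split=> [|a x y xS yS]; first by rewrite unfold_in sh0 rpred0.
by rewrite unfold_in shD shZ rpredD ?rpredZ.
Qed.
HB.instance Definition _ :=
  GRing.isSubmodClosed.Build K M preim_pred preim_subproof.
Lemma preim_comp i x : x \in preim_pred -> comp i x \in preim_pred.
Proof. by move=> xS; rewrite unfold_in -comp_hom; exact: gsubP. Qed.
Definition gpreim : gsub M := GSub preim_comp.
End Preimage.

Section Kernel.
Variables (M N : supermodule K) (f : superhom M N).
Definition ker_pred : {pred M} := fun x => f x == 0.
Lemma ker_subproof : submod_closed ker_pred.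
Proof.
split=> [|a x y /eqP fx /eqP fy]; first by rewrite unfold_in raddf0.
by rewrite unfold_in linearP fx fy scaler0 addr0.
Qed.
HB.instance Definition _ :=
  GRing.isSubmodClosed.Build K M ker_pred ker_subproof.
Lemma ker_comp i x : x \in ker_pred -> comp i x \in ker_pred.
Proof. by move=> /eqP fx; rewrite unfold_in -comp_hom fx raddf0. Qed.
Definition ker : gsub M := GSub ker_comp.
Lemma kerP x : reflect (f x = 0) (x \in ker).
Proof. exact: eqP. Qed.
End Kernel.
End Super.
Arguments comp {K M} i x : simpl never.

Section Tensor.
Variables (K : comPzRingType) (M N : supermodule K).

Inductive tens_rel : freemod K (M * N)%type -> Prop :=
| tens_addl m m' n :
    tens_rel (fdelta (m + m', n) - (fdelta (m, n) + fdelta (m', n)))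
| tens_addr m n n' :
    tens_rel (fdelta (m, n + n') - (fdelta (m, n) + fdelta (m, n')))
| tens_scalel a m n : tens_rel (fdelta (a *: m, n) - a *: fdelta (m, n))
| tens_scaler a m n : tens_rel (fdelta (m, a *: n) - a *: fdelta (m, n)).

Definition tens_mod := quotient (span tens_rel).
HB.instance Definition _ := GRing.Lmodule.on tens_mod.

Definition tens (m : M) (n : N) : tens_mod := qpi (span tens_rel) (fdelta (m, n)).

Lemma tensDl m m' n : tens (m + m') n = tens m n + tens m' n.
Proof.
by rewrite /tens -raddfD; apply/qpi_eq/span_gen; exact: tens_addl.
Qed.
Lemma tensDr m n n' : tens m (n + n') = tens m n + tens m n'.
Proof.
by rewrite /tens -raddfD; apply/qpi_eq/span_gen; exact: tens_addr.
Qed.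
Lemma tensZl a m n : tens (a *: m) n = a *: tens m n.
Proof.
by rewrite /tens -linearZ; apply/qpi_eq/span_gen; exact: tens_scalel.
Qed.
Lemma tensZr a m n : tens m (a *: n) = a *: tens m n.
Proof.
by rewrite /tens -linearZ; apply/qpi_eq/span_gen; exact: tens_scaler.
Qed.
Lemma tens_bilinear : bilinear_map tens.
Proof.
by split=> [n a x y|m a x y]; rewrite ?tensDl ?tensZl ?tensDr ?tensZr.
Qed.

Lemma tens_ind (P : tens_mod -> Prop) :
  P 0 -> (forall a m n t, P t -> P (a *: tens m n + t)) -> forall t, P t.
Proof.
move=> P0 PS t; have [f <-] := qpi_surj t; elim/freemod_ind: f => [|a [m n] f IH].
  by rewrite raddf0.
by rewrite linearP; exact: PS.
Qed.

Section Lift.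
Variables (P : lmodType K) (f : M -> N -> P) (fB : bilinear_map f).

Definition tens_pre : {linear freemod K (M * N)%type -> P} :=
  flift (fun p : M * N => f p.1 p.2).

Lemma tens_pre_rel x : x \in span tens_rel -> tens_pre x = 0.
Proof.
move: x; apply: span_ind => [|x H|a x y _ _ x0 y0].
- exact: raddf0.
- case: H => [m m' n|m n n'|a m n|a m n];
    by rewrite /= fliftB ?fliftD ?fliftZ !flift_delta /=
      ?(bilDl fB) ?(bilDr fB) ?(bilZl fB) ?(bilZr fB) subrr.
- by rewrite linearP x0 y0 scaler0 addr0.
Qed.

Lemma tens_lift_linear : linear (qlift tens_pre : tens_mod -> P).
Proof. exact: (qlift_linear tens_pre_rel). Qed.
Definition tens_lift : {linear tens_mod -> P} :=
  HB.pack (qlift tens_pre : tens_mod -> P)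
    (GRing.isLinear.Build K tens_mod P *:%R _ tens_lift_linear).
Lemma tens_liftE m n : tens_lift (tens m n) = f m n.
Proof.
transitivity (tens_pre (fdelta (m, n))); last exact: flift_delta.
exact: (qlift_pi tens_pre_rel).
Qed.
End Lift.

Inductive tens_homog (k : bool) : tens_mod -> Prop :=
| Tens_homog i j m n : m \in gr M i -> n \in gr N j -> i (+) j = k ->
    tens_homog k (tens m n).
Definition tens_gr k : submodClosed tens_mod := span (tens_homog k).

Lemma tens_in_gr i j m n : m \in gr M i -> n \in gr N j ->
  tens m n \in tens_gr (i (+) j).
Proof. by move=> mi nj; apply/span_gen/(Tens_homog mi nj). Qed.

Lemma tens_gr_dec t : exists t0 t1,
  [/\ t0 \in tens_gr false, t1 \in tens_gr true & t = t0 + t1].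
Proof.
elim/tens_ind: t => [|a m n t [t0 [t1 [t0P t1P ->]]]].
  by exists 0, 0; rewrite !rpred0 addr0.
pose c i j := tens (comp i m) (comp j n).
have cP i j : c i j \in tens_gr (i (+) j) by apply: tens_in_gr; exact: comp_in.
exists (a *: (c false false + c true true) + t0).
exists (a *: (c false true + c true false) + t1); split.
- by rewrite rpredD ?rpredZ ?rpredD // ?(cP false false) ?(cP true true).
- by rewrite rpredD ?rpredZ ?rpredD // ?(cP false true) ?(cP true false).
rewrite addrACA -scalerDr; congr (a *: _ + _).
by rewrite {1}(comp_sum m) {1}(comp_sum n) tensDl !tensDr -!/(c _ _); abel.
Qed.

Definition tens_comp_fun k m n : tens_mod :=
  tens (comp false m) (comp k n) + tens (comp true m) (comp (~~ k) n).
Lemma tens_comp_bilinear k : bilinear_map (tens_comp_fun k).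
Proof.
by split=> [n a x y|m a x y]; rewrite /tens_comp_fun !compD !compZ
  ?tensDl ?tensZl ?tensDr ?tensZr !scalerDr addrACA.
Qed.
Definition tens_comp k := tens_lift (tens_comp_bilinear k).

Lemma tens_comp_id k l t : t \in tens_gr k ->
  tens_comp l t = if l == k then t else 0.
Proof.
move: t; apply: span_ind => [|t [i j m n mi nj <-]|a x y _ _ Hx Hy].
- by rewrite raddf0; case: eqP.
- rewrite tens_liftE /tens_comp_fun !(comp_id _ mi) !(comp_id _ nj).
  by move: i j l mi nj => [] [] [] _ _ /=;
    rewrite ?(bil0l tens_bilinear) ?(bil0r tens_bilinear) ?addr0 ?add0r.
- by rewrite linearP Hx Hy; case: eqP => // _; rewrite scaler0 addr0.
Qed.

Lemma tens_gr_cap t : t \in tens_gr false -> t \in tens_gr true -> t = 0.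
Proof.
by move=> /(tens_comp_id false) E /(tens_comp_id false); rewrite E.
Qed.

Definition tensor : supermodule K := Supermodule tens_gr_dec tens_gr_cap.


Lemma tens_grP i j (m : M) (n : N) : m \in gr M i -> n \in gr N j ->
  (tens m n : tensor) \in gr tensor (i (+) j).
Proof. exact: tens_in_gr. Qed.

Section EvenLift.
Variables (P : supermodule K) (f : M -> N -> P) (fB : bilinear_map f).
Hypothesis f_gr : forall i j m n, m \in gr M i -> n \in gr N j ->
  f m n \in gr P (i (+) j).
Lemma tens_lift_even i t : t \in gr tensor i -> tens_lift fB t \in gr P i.
Proof.
move: t; apply: span_ind => [|t [k j m n mk nj <-]|a x y _ _ xi yi].
- by rewrite raddf0 rpred0.
- by rewrite tens_liftE; exact: f_gr.
- by rewrite linearP rpredD ?rpredZ.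
Qed.
Definition stens_lift : superhom tensor P :=
  @Superhom _ tensor P (tens_lift fB) tens_lift_even.
Lemma stens_liftE m n : stens_lift (tens m n) = f m n.
Proof. exact: tens_liftE. Qed.
End EvenLift.
End Tensor.

Record lieSuperalgebra (K : comPzRingType) := LieSuperalgebra {
  lie_super :> supermodule K;
  br : lie_super -> lie_super -> lie_super;
  br_bilinear : bilinear_map br;
  br_gr : forall i j x y, x \in gr lie_super i -> y \in gr lie_super j ->
    br x y \in gr lie_super (i (+) j);
  br_anti : forall i j x y, x \in gr lie_super i -> y \in gr lie_super j ->
    br x y = - ((-1) ^+ (i && j) *: br y x);
  br_jacobi : forall i j k x y z, x \in gr lie_super i ->
    y \in gr lie_super j -> z \in gr lie_super k ->
    br x (br y z) = br (br x y) z + (-1) ^+ (i && j) *: br y (br x z);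
  br_alt : forall x, x \in gr lie_super false -> br x x = 0
}.

Record lie_hom (K : comPzRingType) (L L' : lieSuperalgebra K) := LieHom {
  lh_hom :> superhom L L';
  lh_br : forall x y, lh_hom (br x y) = br (lh_hom x) (lh_hom y)
}.

Section FreeSuper.
Variables (K : comPzRingType) (X : choiceType) (deg : X -> bool).

Definition free_gr (i : bool) : {pred freemod K X} :=
  fun f => `[< forall x, deg x != i -> fcoef f x = 0 >].
Lemma free_gr_subproof i : submod_closed (free_gr i).
Proof.
split=> [|a f g /asboolP fi /asboolP gi]; apply/asboolP => // x xi.
by rewrite fcoefP fi // gi // mulr0 addr0.
Qed.
HB.instance Definition _ i :=
  GRing.isSubmodClosed.Build K (freemod K X) (free_gr i) (free_gr_subproof i).

Lemma free_restr_fin (f : freemod K X) i :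
  finite_set [set x | ((if deg x == i then fcoef f x else 0) : K^o) != 0].
Proof.
apply: sub_finite_set (fcoef_fin f) => x /=.
by case: (deg x == i) => //; rewrite eqxx.
Qed.
Definition free_restr f i := mkfree (@free_restr_fin f i).

Lemma free_restr_gr f i : free_restr f i \in free_gr i.
Proof. by apply/asboolP => x /negPf xi; rewrite /fcoef /= xi. Qed.

Lemma free_gr_dec f : exists f0 f1,
  [/\ f0 \in free_gr false, f1 \in free_gr true & f = f0 + f1].
Proof.
exists (free_restr f false), (free_restr f true).
split; rewrite ?free_restr_gr //; apply: freemodP => x.
by rewrite fcoefD /fcoef /=; case: (deg x); rewrite /= ?add0r ?addr0.
Qed.

Lemma free_gr_cap f : f \in free_gr false -> f \in free_gr true -> f = 0.
Proof.
move=> /asboolP f0 /asboolP f1; apply: freemodP => x.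
by case E: (deg x); [apply: f0 | apply: f1]; rewrite E.
Qed.

Definition free_super : supermodule K := Supermodule free_gr_dec free_gr_cap.

Lemma fdelta_gr x : (fdelta x : free_super) \in gr free_super (deg x).
Proof.
apply/asboolP => y; rewrite fcoef_delta.
by case: (y =P x) => [->|_ _]; [rewrite eqxx | exact: mulr0n].
Qed.
End FreeSuper.

Inductive magma (G : Type) := Leaf of G | Node of magma G & magma G.
HB.instance Definition _ G := gen_eqMixin (magma G).
HB.instance Definition _ G := gen_choiceMixin (magma G).

Section Presentation.
Variables (K : comPzRingType) (G : Type) (deg : G -> bool).

Fixpoint mdeg (t : magma G) : bool :=
  match t with Leaf g => deg g | Node a b => mdeg a (+) mdeg b end.

(* The free non-associative superalgebra on the graded set G. *)
Definition mfree := free_super K mdeg.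

Definition gen (g : G) : mfree := fdelta (Leaf g).

Definition fmul_fun (f g : mfree) (t : magma G) : K^o :=
  match t with Leaf _ => 0 | Node a b => fcoef f a * fcoef g b end.

Lemma fmul_fin f g : finite_set [set t | fmul_fun f g t != 0].
Proof.
pose A := [set x | fcoef f x != 0]%classic.
pose B := [set x | fcoef g x != 0]%classic.
apply: (@sub_finite_set _ _ ((fun p => Node p.1 p.2) @` (A `*` B))%classic).
  case=> [h|a b] /=; first by rewrite eqxx.
  move=> ab; exists (a, b) => //; split=> /=; apply: contra_neq ab => ->.
    by rewrite mul0r.
  by rewrite mulr0.
by apply/finite_image/finite_setX; exact: fcoef_fin.
Qed.
Definition fmul (f g : mfree) : mfree := mkfree (@fmul_fin f g).

Lemma fmul_leaf f g h : fcoef (fmul f g) (Leaf h) = 0.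
Proof. by []. Qed.
Lemma fmul_node f g a b : fcoef (fmul f g) (Node a b) = fcoef f a * fcoef g b.
Proof. by []. Qed.

Lemma fmul_bilinear : bilinear_map fmul.
Proof.
split=> [g a x y|g a x y]; apply: freemodP => -[h|s t];
  rewrite fcoefP ?fmul_leaf ?mulr0 ?addr0 // !fmul_node fcoefP.
  by rewrite mulrDl mulrA.
by rewrite mulrDr mulrCA.
Qed.

Lemma fmul_delta a b : fmul (fdelta a) (fdelta b) = fdelta (Node a b).
Proof.
apply: freemodP => -[h|s t]; first by rewrite fmul_leaf fcoef_delta; case: eqP.
rewrite fmul_node !fcoef_delta -natrM mulnb.
congr (_%:R); congr nat_of_bool.
by apply/andP/eqP => [[/eqP -> /eqP ->]|[-> ->]].
Qed.

Lemma fmul_gr i j f g : f \in gr mfree i -> g \in gr mfree j ->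
  fmul f g \in gr mfree (i (+) j).
Proof.
move=> /asboolP fi /asboolP gj; apply/asboolP => -[h|s t] //= st.
rewrite fmul_node; case: (eqVneq (mdeg s) i) => [si|/fi ->]; last by rewrite mul0r.
case: (eqVneq (mdeg t) j) => [tj|/gj ->]; last by rewrite mulr0.
by rewrite si tj eqxx in st.
Qed.

Lemma gen_gr g : gen g \in gr mfree (deg g).
Proof. exact: (fdelta_gr K mdeg (Leaf g)). Qed.

(* The Lie superalgebra generated by G subject to the relations x = 0 for x in
   R: the quotient of [mfree] by the two-sided ideal generated by R and the
   Lie superalgebra identities. *)
Section Relations.
Variable R : mfree -> Prop.
Hypothesis RH : forall x, R x -> exists i, x \in gr mfree i.

Inductive lie_rel : mfree -> Prop :=
| lr_rel x : R x -> lie_rel x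
| lr_anti i j x y : x \in gr mfree i -> y \in gr mfree j ->
    lie_rel (fmul x y + (-1) ^+ (i && j) *: fmul y x)
| lr_jacobi i j k x y z :
    x \in gr mfree i -> y \in gr mfree j -> z \in gr mfree k ->
    lie_rel (fmul x (fmul y z)
             - (fmul (fmul x y) z + (-1) ^+ (i && j) *: fmul y (fmul x z)))
| lr_alt x : x \in gr mfree false -> lie_rel (fmul x x).

Inductive in_lie_ideal : mfree -> Prop :=
| li_0 : in_lie_ideal 0
| li_rel x : lie_rel x -> in_lie_ideal x
| li_lin a x y : in_lie_ideal x -> in_lie_ideal y -> in_lie_ideal (a *: x + y)
| li_mull x y : in_lie_ideal y -> in_lie_ideal (fmul x y)
| li_mulr x y : in_lie_ideal x -> in_lie_ideal (fmul x y).

Definition lie_ideal : {pred mfree} := fun x => `[< in_lie_ideal x >].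
Lemma lie_ideal_subproof : submod_closed lie_ideal.
Proof.
split=> [|a x y /asboolP xI /asboolP yI]; apply/asboolP; first exact: li_0.
exact: li_lin.
Qed.
HB.instance Definition _ :=
  GRing.isSubmodClosed.Build K mfree lie_ideal lie_ideal_subproof.

Lemma lie_ideal_rel x : lie_rel x -> x \in lie_ideal.
Proof. by move=> xR; apply/asboolP/li_rel. Qed.
Lemma lie_ideal_mull x y : y \in lie_ideal -> fmul x y \in lie_ideal.
Proof. by move=> /asboolP yI; apply/asboolP/li_mull. Qed.
Lemma lie_ideal_mulr x y : x \in lie_ideal -> fmul x y \in lie_ideal.
Proof. by move=> /asboolP yI; apply/asboolP/li_mulr. Qed.

Lemma lie_rel_homog x : lie_rel x -> exists i, x \in gr mfree i.
Proof.
case=> {x} [x /RH //|i j x y xi yj|i j k x y z xi yj zk|x x0].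
- exists (i (+) j); apply: rpredD; first exact: fmul_gr.
  by apply: rpredZ; rewrite addbC; exact: fmul_gr.
- exists (i (+) (j (+) k)); apply: submodB.
    exact: (fmul_gr xi (fmul_gr yj zk)).
  apply: rpredD; first by rewrite addbA; exact: (fmul_gr (fmul_gr xi yj) zk).
  by apply: rpredZ; rewrite addbCA; exact: (fmul_gr yj (fmul_gr xi zk)).
- by exists false; exact: (fmul_gr x0 x0).
Qed.

Lemma comp_fmul k x y : comp k (fmul x y) =
  fmul (comp false x) (comp k y) + fmul (comp true x) (comp (~~ k) y).
Proof.
rewrite {1}(comp_sum x) {1}(comp_sum y) !(bilDl fmul_bilinear).
rewrite !(bilDr fmul_bilinear) !compD.
rewrite !(comp_id k (fmul_gr (comp_in _ x) (comp_in _ y))).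
by case: k; rewrite /= ?addr0 ?add0r.
Qed.

Lemma lie_ideal_comp i x : x \in lie_ideal -> comp i x \in lie_ideal.
Proof.
move=> /asboolP xI; elim: xI i => {x} [|x xR|a x y _ xI _ yI|x y _ yI|x y _ xI] i.
- by rewrite comp0 rpred0.
- have [k xk] := lie_rel_homog xR; rewrite (comp_id _ xk).
  by case: eqP => _; [exact: lie_ideal_rel | exact: rpred0].
- by rewrite compD compZ rpredD ?rpredZ.
- by rewrite comp_fmul rpredD ?lie_ideal_mull.
- by rewrite comp_fmul rpredD ?lie_ideal_mulr.
Qed.
Definition lie_gideal : gsub mfree := GSub lie_ideal_comp.

Definition pres_super := quot_super lie_gideal.
Local Notation qp := (sqpi lie_gideal).

Definition pres_br (p q : pres_super) : pres_super := qp (fmul (repr p) (repr q)).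

Lemma pres_brE x y : pres_br (qp x) (qp y) = qp (fmul x y).
Proof.
apply/sqpi_eq; set x' := repr _; set y' := repr _.
have xE : x' - x \in lie_gideal by apply/sqpi_eq; exact: (reprK (qp x)).
have yE : y' - y \in lie_gideal by apply/sqpi_eq; exact: (reprK (qp y)).
rewrite (_ : _ - _ = fmul x' (y' - y) + fmul (x' - x) y).
  by apply: rpredD; [exact: lie_ideal_mull | exact: lie_ideal_mulr].
by rewrite (bilBl fmul_bilinear) (bilBr fmul_bilinear); abel.
Qed.

Lemma pres_br_bilinear : bilinear_map pres_br.
Proof.
split=> [r a p q|r a p q]; have [x <-] := sqpi_surj p; have [y <-] := sqpi_surj q;
  have [z <-] := sqpi_surj r; rewrite -linearP !pres_brE -linearP.
  by rewrite (bilDl fmul_bilinear) (bilZl fmul_bilinear).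
by rewrite (bilDr fmul_bilinear) (bilZr fmul_bilinear).
Qed.

Lemma pres_br_gr i j p q : p \in gr pres_super i -> q \in gr pres_super j ->
  pres_br p q \in gr pres_super (i (+) j).
Proof.
move=> /sqpi_surj_gr [x xi <-] /sqpi_surj_gr [y yj <-].
by rewrite pres_brE; apply/sh_even/fmul_gr.
Qed.

Lemma pres_br_anti i j p q : p \in gr pres_super i -> q \in gr pres_super j ->
  pres_br p q = - ((-1) ^+ (i && j) *: pres_br q p).
Proof.
move=> /sqpi_surj_gr [x xi <-] /sqpi_surj_gr [y yj <-].
rewrite !pres_brE -linearZ -raddfN; apply/sqpi_eq; rewrite opprK.
by apply: lie_ideal_rel; exact: lr_anti.
Qed.

Lemma pres_br_jacobi i j k p q r : p \in gr pres_super i ->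
  q \in gr pres_super j -> r \in gr pres_super k ->
  pres_br p (pres_br q r) =
  pres_br (pres_br p q) r + (-1) ^+ (i && j) *: pres_br q (pres_br p r).
Proof.
move=> /sqpi_surj_gr [x xi <-] /sqpi_surj_gr [y yj <-] /sqpi_surj_gr [z zk <-].
rewrite !pres_brE -linearZ -raddfD; apply/sqpi_eq.
by apply: lie_ideal_rel; exact: (lr_jacobi xi yj zk).
Qed.

Lemma pres_br_alt p : p \in gr pres_super false -> pres_br p p = 0.
Proof.
move=> /sqpi_surj_gr [x x0 <-]; rewrite pres_brE; apply/sqpi0.
by apply: lie_ideal_rel; exact: lr_alt.
Qed.

Definition presented_lie : lieSuperalgebra K :=
  LieSuperalgebra pres_br_bilinear pres_br_gr pres_br_anti pres_br_jacobi
    pres_br_alt.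

Definition pgen (g : G) : presented_lie := qp (gen g).

Lemma pgen_gr g : pgen g \in gr presented_lie (deg g).
Proof. exact/sh_even/gen_gr. Qed.

Lemma pres_rel x : R x -> qp x = 0.
Proof. by move=> xR; apply/sqpi0/lie_ideal_rel/lr_rel. Qed.

Section Lift.
Variables (L : lieSuperalgebra K) (phi : G -> L).
Hypothesis phi_gr : forall g, phi g \in gr L (deg g).

Fixpoint mag_ev (t : magma G) : L :=
  match t with Leaf g => phi g | Node a b => br (mag_ev a) (mag_ev b) end.

Lemma mag_ev_gr t : mag_ev t \in gr L (mdeg t).
Proof. by elim: t => //= a aP b bP; exact: br_gr. Qed.

Definition mext_fun (x : mfree) : L := flift mag_ev x.
Lemma mext_linear : linear mext_fun.
Proof. exact: flift_linear. Qed.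
HB.instance Definition _ := GRing.isLinear.Build K mfree L *:%R mext_fun mext_linear.
Lemma mext_even i x : x \in gr mfree i -> mext_fun x \in gr L i.
Proof.
move=> /asboolP xi; have [r ur xr] := freemod_supp x.
rewrite /mext_fun (fliftE _ ur xr); apply: rpred_sum => t _.
case: (eqVneq (mdeg t) i) => [<-|/xi ->]; last by rewrite scale0r rpred0.
by apply/rpredZ/mag_ev_gr.
Qed.
Definition mext : superhom mfree L := Superhom mext_even.

Lemma mext_gen g : mext (gen g) = phi g.
Proof. exact: flift_delta. Qed.

Lemma mext_fmul x y : mext (fmul x y) = br (mext x) (mext y).
Proof.
elim/freemod_ind: x => [|a s x IH].
  by rewrite (bil0l fmul_bilinear) raddf0 (bil0l (@br_bilinear _ L)).
rewrite (bilDl fmul_bilinear) (bilZl fmul_bilinear) !linearP IH.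
rewrite (bilDl (@br_bilinear _ L)) (bilZl (@br_bilinear _ L)).
congr (a *: _ + _); elim/freemod_ind: y {IH} => [|b t y IH].
  by rewrite (bil0r fmul_bilinear) raddf0 (bil0r (@br_bilinear _ L)).
rewrite (bilDr fmul_bilinear) (bilZr fmul_bilinear) !linearP IH.
rewrite (bilDr (@br_bilinear _ L)) (bilZr (@br_bilinear _ L)).
by rewrite fmul_delta /= /mext_fun !flift_delta.
Qed.

Hypothesis phi_rel : forall x, R x -> mext x = 0.

Lemma mext_ideal x : x \in lie_gideal -> mext x = 0.
Proof.
move=> /asboolP; elim=> {x} [|x xR|a x y _ x0 _ y0|x y _ y0|x y _ x0].
- exact: raddf0.
- case: xR => {x} [x|i j x y xi yj|i j k x y z xi yj zk|x xe].
  + exact: phi_rel.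
  + rewrite shD shZ !mext_fmul.
    by rewrite (br_anti (mext_even xi) (mext_even yj)) addNr.
  + rewrite shB shD shZ !mext_fmul.
    by rewrite (br_jacobi (mext_even xi) (mext_even yj) (mext_even zk)) subrr.
  + by rewrite mext_fmul (br_alt (mext_even xe)).
- by rewrite linearP x0 y0 scaler0 addr0.
- by rewrite mext_fmul y0 (bil0r (@br_bilinear _ L)).
- by rewrite mext_fmul x0 (bil0l (@br_bilinear _ L)).
Qed.

Definition pres_lift_hom : superhom presented_lie L := sqlift mext_ideal.
Lemma pres_lift_br p q : pres_lift_hom (br p q) = br (pres_lift_hom p) (pres_lift_hom q).
Proof.
have [x <-] := sqpi_surj p; have [y <-] := sqpi_surj q.
by rewrite -[br _ _]/(pres_br _ _) pres_brE !sqliftE mext_fmul.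
Qed.
Definition pres_lift : lie_hom presented_lie L := LieHom pres_lift_br.
Lemma pres_liftE g : pres_lift (pgen g) = phi g.
Proof.
transitivity (mext (gen g)); last exact: mext_gen.
exact: (sqliftE mext_ideal).
Qed.
End Lift.
End Relations.
End Presentation.

Record lie_action (K : comPzRingType) (P M : lieSuperalgebra K) := LieAction {
  act :> P -> M -> M;
  act_bilinear : bilinear_map act;
  act_gr : forall i j p m, p \in gr P i -> m \in gr M j ->
    act p m \in gr M (i (+) j);
  act_brl : forall i j p p' m, p \in gr P i -> p' \in gr P j ->
    act (br p p') m = act p (act p' m) - (-1) ^+ (i && j) *: act p' (act p m);
  act_brr : forall i j p m m', p \in gr P i -> m \in gr M j ->
    act p (br m m') = br (act p m) m' + (-1) ^+ (i && j) *: br m (act p m')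
}.

Record crossed_module (K : comPzRingType) (P : lieSuperalgebra K) :=
CrossedModule {
  xm_lie :> lieSuperalgebra K;
  xm_bd : lie_hom xm_lie P;
  xm_act : lie_action P xm_lie;
  xm_bd_act : forall p m, xm_bd (xm_act p m) = br p (xm_bd m);
  xm_peiffer : forall m m', xm_act (xm_bd m) m' = br m m'
}.

Section NonabelianTensor.
Variables (K : comPzRingType) (M N : lieSuperalgebra K).
(* [aM m n] is the action of M on N and [aN n m] that of N on M. *)
Variables (aM : lie_action M N) (aN : lie_action N M).

(* A symbol m ⊗ n carries the degrees of m and n. Only 0 has both degrees, and
   the symbols with a zero factor all vanish by [nt_scalel] and [nt_scaler]. *)
Record tsym := TSym {
  ts_i : bool; ts_j : bool; ts_m : M; ts_n : N;
  ts_mP : ts_m \in gr M ts_i; ts_nP : ts_n \in gr N ts_j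
}.
Definition ts_deg (s : tsym) := ts_i s (+) ts_j s.

Definition tsym_gen i j m n (mP : m \in gr M i) (nP : n \in gr N j) :
  mfree K ts_deg := gen K ts_deg (TSym mP nP).
Local Notation T := tsym_gen.

Inductive natens_rel : mfree K ts_deg -> Prop :=
| nt_scalel a i j m n (mP : m \in gr M i) (nP : n \in gr N j) :
    natens_rel (a *: T mP nP - T (rpredZ a mP) nP)
| nt_scaler a i j m n (mP : m \in gr M i) (nP : n \in gr N j) :
    natens_rel (a *: T mP nP - T mP (rpredZ a nP))
| nt_addl i j m m' n (mP : m \in gr M i) (mP' : m' \in gr M i)
    (nP : n \in gr N j) :
    natens_rel (T (rpredD mP mP') nP - (T mP nP + T mP' nP))
| nt_addr i j m n n' (mP : m \in gr M i) (nP : n \in gr N j)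
    (nP' : n' \in gr N j) :
    natens_rel (T mP (rpredD nP nP') - (T mP nP + T mP nP'))
| nt_brl i i' j m m' n (mP : m \in gr M i) (mP' : m' \in gr M i')
    (nP : n \in gr N j) :
    natens_rel (T (br_gr mP mP') nP
      - (T mP (act_gr aM mP' nP)
         - (-1) ^+ (i && i') *: T mP' (act_gr aM mP nP)))
| nt_brr i j j' m n n' (mP : m \in gr M i) (nP : n \in gr N j)
    (nP' : n' \in gr N j') :
    natens_rel (T mP (br_gr nP nP')
      - ((-1) ^+ (j' && (i (+) j)) *: T (act_gr aN nP' mP) nP
         - (-1) ^+ (i && j) *: T (act_gr aN nP mP) nP'))
| nt_br i j i' j' m n m' n' (mP : m \in gr M i) (nP : n \in gr N j)
    (mP' : m' \in gr M i') (nP' : n' \in gr N j') :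
    natens_rel (fmul (T mP nP) (T mP' nP')
      + (-1) ^+ (i && j) *: T (act_gr aN nP mP) (act_gr aM mP' nP')).

Lemma tsym_gr i j m n (mP : m \in gr M i) (nP : n \in gr N j) :
  T mP nP \in gr (mfree K ts_deg) (i (+) j).
Proof. exact: (gen_gr K ts_deg (TSym mP nP)). Qed.

Lemma tsym_gr_eq k i j m n (mP : m \in gr M i) (nP : n \in gr N j) :
  i (+) j = k -> T mP nP \in gr (mfree K ts_deg) k.
Proof. by move=> <-; exact: tsym_gr. Qed.

Lemma natens_rel_homog x : natens_rel x ->
  exists i, x \in gr (mfree K ts_deg) i.
Proof.
case=> {x} [a i j m n mP nP|a i j m n mP nP|i j m m' n mP mP' nP
  |i j m n n' mP nP nP'|i i' j m m' n mP mP' nP|i j j' m n n' mP nP nP'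
  |i j i' j' m n m' n' mP nP mP' nP'].
- by exists (i (+) j); apply: submodB; rewrite ?rpredZ // tsym_gr.
- by exists (i (+) j); apply: submodB; rewrite ?rpredZ // tsym_gr.
- by exists (i (+) j); apply: submodB; rewrite ?rpredD // tsym_gr.
- by exists (i (+) j); apply: submodB; rewrite ?rpredD // tsym_gr.
- exists ((i (+) i') (+) j); apply: submodB; first exact: tsym_gr.
  apply: submodB; first by apply: tsym_gr_eq; rewrite addbA.
  by apply: rpredZ; apply: tsym_gr_eq; rewrite addbCA addbA.
- exists (i (+) (j (+) j')); apply: submodB; first exact: tsym_gr.
  apply: submodB; apply: rpredZ; apply: tsym_gr_eq.
    by rewrite -addbA addbC -addbA.
  by rewrite addbA [i (+) j]addbC.
- exists ((i (+) j) (+) (i' (+) j')); apply: rpredD.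
    by apply: fmul_gr; exact: tsym_gr.
  by apply: rpredZ; apply: tsym_gr_eq; rewrite [i (+) j]addbC.
Qed.

Definition natensor : lieSuperalgebra K := presented_lie natens_rel_homog.

Definition naten i j m n (mP : m \in gr M i) (nP : n \in gr N j) : natensor :=
  pgen natens_rel_homog (TSym mP nP).
End NonabelianTensor.

Section CrossedModuleTheory.
Variables (K : comPzRingType) (P : lieSuperalgebra K) (X : crossed_module P).
Local Notation "∂" := (xm_bd X).

Definition xm_back_fun (m : X) (p : P) : P := br (∂ m) p.

Lemma xm_back_bilinear : bilinear_map xm_back_fun.
Proof.
split=> [p a x y|m a x y]; rewrite /xm_back_fun.
  by rewrite shD shZ (bilDl (@br_bilinear _ P)) (bilZl (@br_bilinear _ P)).
by rewrite (bilDr (@br_bilinear _ P)) (bilZr (@br_bilinear _ P)).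
Qed.

Lemma xm_back_gr i j m p : m \in gr X i -> p \in gr P j ->
  xm_back_fun m p \in gr P (i (+) j).
Proof. by move=> mi pj; apply: br_gr => //; exact: sh_even. Qed.

Lemma homog_ind (M : supermodule K) (Q : M -> Prop) :
  (forall x y, Q x -> Q y -> Q (x + y)) ->
  (forall i x, x \in gr M i -> Q x) -> forall x, Q x.
Proof.
by move=> QD QH x; rewrite (comp_sum x); apply: QD; apply: QH (comp_in _ _).
Qed.

Lemma xm_back_brl i j m m' p : m \in gr X i -> m' \in gr X j ->
  xm_back_fun (br m m') p = xm_back_fun m (xm_back_fun m' p)
    - (-1) ^+ (i && j) *: xm_back_fun m' (xm_back_fun m p).
Proof.
move=> mi mj; rewrite /xm_back_fun lh_br; elim/homog_ind: p => [p q|k p pk].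
  by rewrite !(bilDr (@br_bilinear _ P)) => -> ->; rewrite scalerDr; abel.
rewrite (br_jacobi (sh_even ∂ mi) (sh_even ∂ mj) pk); abel.
Qed.

Lemma xm_back_brr i j m p q : m \in gr X i -> p \in gr P j ->
  xm_back_fun m (br p q) = br (xm_back_fun m p) q
    + (-1) ^+ (i && j) *: br p (xm_back_fun m q).
Proof.
move=> mi pj; rewrite /xm_back_fun; elim/homog_ind: q => [q r|k q qk].
  by rewrite !(bilDr (@br_bilinear _ P)) => -> ->; rewrite scalerDr; abel.
exact: (br_jacobi (sh_even ∂ mi) pj qk).
Qed.

(* ^m p = [∂ m, p] *)
Definition xm_back : lie_action X P :=
  LieAction xm_back_bilinear xm_back_gr xm_back_brl xm_back_brr.

Definition xm_tensor : lieSuperalgebra K := natensor (xm_act X) xm_back.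

Definition nu_sym (s : tsym P X) : X := xm_act X (ts_m s) (ts_n s).

Lemma nu_sym_gr s : nu_sym s \in gr X (ts_deg s).
Proof. by case: s => i j p m pP mP; exact: act_gr. Qed.

Lemma nu_sym_rel x : natens_rel (xm_act X) xm_back x -> mext nu_sym_gr x = 0.
Proof.
have aB := act_bilinear (xm_act X); have bB := @br_bilinear _ P.
have gE i j p m (pP : p \in gr P i) (mP : m \in gr X j) :
  mext nu_sym_gr (tsym_gen pP mP) = xm_act X p m by exact: mext_gen.
case=> {x} [a i j m n mP nP|a i j m n mP nP|i j m m' n mP mP' nP
  |i j m n n' mP nP nP'|i i' j m m' n mP mP' nP|i j j' m n n' mP nP nP'
  |i j i' j' m n m' n' mP nP mP' nP'].
- by rewrite shB shZ !gE (bilZl aB) subrr.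
- by rewrite shB shZ !gE (bilZr aB) subrr.
- by rewrite shB shD !gE (bilDl aB) subrr.
- by rewrite shB shD !gE (bilDr aB) subrr.
- by rewrite !shB shZ !gE (act_brl _ _ mP mP') subrr.
- rewrite !shB !shZ !gE /= /xm_back_fun.
  rewrite (br_anti (sh_even ∂ nP') mP) (br_anti (sh_even ∂ nP) mP).
  rewrite -!xm_bd_act !(bilNl aB) !(bilZl aB) !xm_peiffer.
  rewrite (act_brr _ _ mP nP).
  rewrite [br n (xm_act X m n')](br_anti nP (act_gr _ mP nP')).
  by case: i j j' {mP nP nP'} => [] [] [] /=;
    rewrite ?(expr0, expr1, scale1r, scaleN1r); abel.
- rewrite shD shZ mext_fmul !gE /= /xm_back_fun.
  rewrite (br_anti (sh_even ∂ nP) mP) -xm_bd_act (bilNl aB) (bilZl aB).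
  rewrite xm_peiffer andbC.
  by case: (j && i); rewrite ?(expr0, expr1, scale1r, scaleN1r); abel.
Qed.

Definition xm_nu : lie_hom xm_tensor X :=
  pres_lift (@natens_rel_homog _ _ _ _ _) nu_sym_rel.

Lemma xm_nuE i j p m (pP : p \in gr P i) (mP : m \in gr X j) :
  xm_nu (naten (xm_act X) xm_back pP mP) = xm_act X p m.
Proof. exact: pres_liftE. Qed.

(* H_1(P, X) = Ker (ν : P ⊗ X -> X, p ⊗ m |-> ^p m) *)
Definition H1 : supermodule K := sub_super (ker xm_nu).
End CrossedModuleTheory.

Record superalgebra (K : comPzRingType) := Superalgebra {
  sa_super :> supermodule K;
  smul : sa_super -> sa_super -> sa_super;
  sone : sa_super;
  smul_bilinear : bilinear_map smul;
  smul_gr : forall i j x y, x \in gr sa_super i -> y \in gr sa_super j ->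
    smul x y \in gr sa_super (i (+) j);
  smulA : associative smul;
  smul1l : left_id sone smul;
  smul1r : right_id sone smul
}.

Section BracketSubmodule.
Variables (K : comPzRingType) (L : lieSuperalgebra K).

Definition full_pred : {pred L} := predT.
Lemma full_subproof : submod_closed full_pred.
Proof. by []. Qed.
HB.instance Definition _ :=
  GRing.isSubmodClosed.Build K L full_pred full_subproof.
Definition gfull : gsub L := @GSub _ L full_pred (fun _ _ _ => isT).

Inductive bracket_of (S T : gsub L) : L -> Prop :=
| Bracket_of m n : m \in S -> n \in T -> bracket_of S T (br m n).

Lemma bracket_of_comp S T i x : bracket_of S T x ->
  comp i x \in span (bracket_of S T).
Proof.
have bB := @br_bilinear _ L.
case=> m n mS nT; rewrite {1}(comp_sum m) {1}(comp_sum n).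
rewrite !(bilDl bB) !(bilDr bB) !compD.
rewrite !(comp_id i (br_gr (comp_in _ m) (comp_in _ n))).
have H j k : br (comp j m) (comp k n) \in span (bracket_of S T).
  by apply/span_gen/Bracket_of; exact: gsubP.
by rewrite !rpredD //; case: eqP => _; rewrite ?rpred0.
Qed.

(* [S, T] *)
Definition brspan (S T : gsub L) : gsub L := gspan (@bracket_of_comp S T).

Lemma brspanP (S T : gsub L) m n : m \in S -> n \in T -> br m n \in brspan S T.
Proof. by move=> mS nT; apply/span_gen/Bracket_of. Qed.
End BracketSubmodule.
Arguments gfull {K} L.

Section IdealCrossedModule.
Variables (K : comPzRingType) (L : lieSuperalgebra K) (I : gsub L).
Hypothesis Iideal : forall x y, y \in I -> br x y \in I.
Local Notation bB := (@br_bilinear _ L).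

Definition ideal_act_fun (x : L) (y : sub_super I) : sub_super I :=
  exist (fun z => z \in I) (br x (sub_val y)) (Iideal x (sub_valP y)).
Lemma ideal_act_val x y : sub_val (ideal_act_fun x y) = br x (sub_val y).
Proof. by []. Qed.

Definition ideal_br (x y : sub_super I) := ideal_act_fun (sub_val x) y.
Lemma ideal_br_val x y : sub_val (ideal_br x y) = br (sub_val x) (sub_val y).
Proof. by []. Qed.

Lemma sub_valD (x y : sub_super I) : sub_val (x + y) = sub_val x + sub_val y.
Proof. by []. Qed.
Lemma sub_valN (x : sub_super I) : sub_val (- x) = - sub_val x.
Proof. by []. Qed.
Lemma sub_valZ a (x : sub_super I) : sub_val (a *: x) = a *: sub_val x.
Proof. by []. Qed.
Let valE := (sub_valD, sub_valN, sub_valZ, ideal_act_val, ideal_br_val).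

Lemma ideal_act_bilinear : bilinear_map ideal_act_fun.
Proof.
split=> [y a x x'|x a y y']; apply: sub_val_inj; rewrite !valE.
  by rewrite (bilDl bB) (bilZl bB).
by rewrite (bilDr bB) (bilZr bB).
Qed.
Lemma ideal_act_gr i j x y : x \in gr L i -> y \in gr (sub_super I) j ->
  ideal_act_fun x y \in gr (sub_super I) (i (+) j).
Proof. exact: br_gr. Qed.

Lemma ideal_br_bilinear : bilinear_map ideal_br.
Proof.
split=> [y a x x'|x a y y']; apply: sub_val_inj; rewrite !valE.
  by rewrite (bilDl bB) (bilZl bB).
by rewrite (bilDr bB) (bilZr bB).
Qed.
Lemma ideal_br_gr i j x y : x \in gr (sub_super I) i ->
  y \in gr (sub_super I) j -> ideal_br x y \in gr (sub_super I) (i (+) j).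
Proof. exact: br_gr. Qed.
Lemma ideal_br_anti i j x y : x \in gr (sub_super I) i ->
  y \in gr (sub_super I) j ->
  ideal_br x y = - ((-1) ^+ (i && j) *: ideal_br y x).
Proof. by move=> xi yj; apply: sub_val_inj; rewrite !valE; exact: br_anti. Qed.
Lemma ideal_br_jacobi i j k x y z : x \in gr (sub_super I) i ->
  y \in gr (sub_super I) j -> z \in gr (sub_super I) k ->
  ideal_br x (ideal_br y z) =
  ideal_br (ideal_br x y) z + (-1) ^+ (i && j) *: ideal_br y (ideal_br x z).
Proof.
by move=> xi yj zk; apply: sub_val_inj; rewrite !valE; exact: (br_jacobi xi yj zk).
Qed.
Lemma ideal_br_alt x : x \in gr (sub_super I) false -> ideal_br x x = 0.
Proof. by move=> x0; apply: sub_val_inj; exact: br_alt. Qed.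

Definition ideal_lie : lieSuperalgebra K :=
  LieSuperalgebra ideal_br_bilinear ideal_br_gr ideal_br_anti ideal_br_jacobi
    ideal_br_alt.

Definition ideal_incl : lie_hom ideal_lie L :=
  @LieHom K ideal_lie L (sub_incl I) (fun _ _ => erefl).

Lemma br_jacobi_gen i j x y z : x \in gr L i -> y \in gr L j ->
  br x (br y z) = br (br x y) z + (-1) ^+ (i && j) *: br y (br x z).
Proof.
move=> xi yj; elim/homog_ind: z => [z t|k z zk]; last exact: (br_jacobi xi yj zk).
by rewrite !(bilDr bB) => -> ->; rewrite scalerDr; abel.
Qed.

Lemma ideal_act_brl i j x x' (y : ideal_lie) : x \in gr L i -> x' \in gr L j ->
  ideal_act_fun (br x x') y = ideal_act_fun x (ideal_act_fun x' y)
    - (-1) ^+ (i && j) *: ideal_act_fun x' (ideal_act_fun x y).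
Proof.
move=> xi xj; apply: sub_val_inj; rewrite !valE (br_jacobi_gen _ xi xj).
by rewrite addrK.
Qed.
Lemma ideal_act_brr i j x (y y' : ideal_lie) : x \in gr L i ->
  y \in gr ideal_lie j ->
  ideal_act_fun x (br y y') = @br K ideal_lie (ideal_act_fun x y) y'
    + (-1) ^+ (i && j) *: br y (ideal_act_fun x y').
Proof.
move=> xi yj; apply: sub_val_inj; rewrite !valE; exact: (br_jacobi_gen _ xi yj).
Qed.
Definition ideal_act : lie_action L ideal_lie :=
  @LieAction K L ideal_lie ideal_act_fun ideal_act_bilinear ideal_act_gr
    ideal_act_brl ideal_act_brr.

Definition ideal_xmod : crossed_module L :=
  @CrossedModule K L ideal_lie ideal_incl ideal_act
    (fun _ _ => erefl) (fun _ _ => erefl).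
End IdealCrossedModule.

Section SuperalgebraConstructions.
Variables (K : comPzRingType) (A : superalgebra K).
Local Notation "x • y" := (smul x y) (at level 40, left associativity).
Local Notation mB := (@smul_bilinear _ A).

(* Bilinear extension of [a, b] = ab - (-1)^(|a||b|) ba; see [sbrE]. *)
Definition sbr (x y : A) : A :=
  \sum_(i : bool) \sum_(j : bool)
    (comp i x • comp j y - (-1) ^+ (i && j) *: (comp j y • comp i x)).

Lemma sbr_expand x y : sbr x y =
  x • y - (comp false y • comp false x + comp true y • comp false x
           + comp false y • comp true x - comp true y • comp true x).
Proof.
rewrite /sbr !big_bool /= !(expr0, expr1, scale1r, scaleN1r).
have -> : x • y =
    (comp false x + comp true x) • (comp false y + comp true y).
  by rewrite -!comp_sum.
rewrite !(bilDl mB) !(bilDr mB); abel.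
Qed.

Lemma sbr_bilinear : bilinear_map sbr.
Proof.
by split=> [y a x x'|x a y y']; rewrite /sbr scaler_sumr -big_split;
  apply: eq_bigr => i _ /=; rewrite scaler_sumr -big_split;
  apply: eq_bigr => j _ /=; rewrite !compD !compZ !(bilDl mB) !(bilDr mB)
    !(bilZl mB) !(bilZr mB); case: (i && j);
  rewrite /= !(expr0, expr1, scale1r, scaleN1r) scalerBr
    ?scalerN; abel.
Qed.

Lemma sbrE i j x y : x \in gr A i -> y \in gr A j ->
  sbr x y = x • y - (-1) ^+ (i && j) *: (y • x).
Proof.
move=> xi yj; rewrite sbr_expand !(comp_id _ xi) !(comp_id _ yj).
by case: i j xi yj => [] [] _ _ /=;
  rewrite !(expr0, expr1, scale1r, scaleN1r) ?(bil0l mB) ?(bil0r mB); abel.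
Qed.

Lemma sbr_gr i j x y : x \in gr A i -> y \in gr A j ->
  sbr x y \in gr A (i (+) j).
Proof.
move=> xi yj; rewrite (sbrE xi yj); apply: submodB; first exact: smul_gr.
by apply: rpredZ; rewrite addbC; exact: smul_gr.
Qed.

Lemma sbr_anti i j x y : x \in gr A i -> y \in gr A j ->
  sbr x y = - ((-1) ^+ (i && j) *: sbr y x).
Proof.
move=> xi yj; rewrite (sbrE xi yj) (sbrE yj xi) andbC.
by case: (j && i); rewrite !(expr0, expr1, scale1r, scaleN1r); abel.
Qed.

Lemma sbr_jacobi i j k x y z : x \in gr A i -> y \in gr A j -> z \in gr A k ->
  sbr x (sbr y z) = sbr (sbr x y) z + (-1) ^+ (i && j) *: sbr y (sbr x z).
Proof.
move=> xi yj zk.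
rewrite (sbrE xi (sbr_gr yj zk)) (sbrE (sbr_gr xi yj) zk) (sbrE yj (sbr_gr xi zk)).
rewrite (sbrE yj zk) (sbrE xi yj) (sbrE xi zk).
rewrite !(bilBl mB) !(bilBr mB) !(bilZl mB) !(bilZr mB) !smulA.
by case: i j k xi yj zk => [] [] [] _ _ _ /=;
  rewrite !(expr0, expr1, scale1r, scaleN1r); abel.
Qed.

Lemma sbr_alt x : x \in gr A false -> sbr x x = 0.
Proof.
by move=> x0; rewrite (sbrE x0 x0) /= expr0 scale1r subrr.
Qed.

Definition lieA : lieSuperalgebra K :=
  LieSuperalgebra sbr_bilinear sbr_gr sbr_anti sbr_jacobi sbr_alt.

(* [A, A] *)
Definition commA : gsub lieA := brspan (gfull lieA) (gfull lieA).

Lemma commA_ideal x y : y \in commA -> br x y \in commA.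
Proof. by move=> _; exact: brspanP. Qed.

Definition comm_xmod : crossed_module lieA := ideal_xmod commA_ideal.

Section CyclicMaps.
Variables (W : lmodType K) (f : A -> A -> W) (fB : bilinear_map f).
Hypothesis f_anti : forall i j a b, a \in gr A i -> b \in gr A j ->
  f a b = - ((-1) ^+ (i && j) *: f b a).
Hypothesis f_cycl : forall i j k a b c,
  a \in gr A i -> b \in gr A j -> c \in gr A k ->
  f (a • b) c = f a (b • c) - (-1) ^+ (k && (i (+) j)) *: f (c • a) b.

Lemma cycl_der i j k a b c : a \in gr A i -> b \in gr A j -> c \in gr A k ->
  f a (sbr b c) = f (sbr a b) c + (-1) ^+ (i && j) *: f b (sbr a c).
Proof.
move=> ai bj ck; rewrite (sbrE bj ck) (sbrE ai bj) (sbrE ai ck).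
rewrite !(bilBl fB) !(bilBr fB) !(bilZl fB) !(bilZr fB).
rewrite (f_cycl ai bj ck) (f_cycl bj ai ck).
rewrite (f_anti (smul_gr ck ai) bj) (f_anti (smul_gr ck bj) ai).
by case: i j k ai bj ck => [] [] [] _ _ _ /=;
  rewrite !(expr0, expr1, scale1r, scaleN1r); abel.
Qed.

Lemma cycl_alt i a b : a \in gr A i -> b \in gr A i ->
  f (sbr a b) (sbr a b) = 0.
Proof.
move=> ai bi; have ui := sbr_gr ai bi.
have uE := sbrE ai bi; rewrite andbb in uE.
rewrite {1}uE (bilBl fB) (bilZl fB) (f_cycl ai bi ui) (f_cycl bi ai ui).
rewrite (f_anti (smul_gr ui bi) ai) (f_anti bi (smul_gr ai ui)) uE.
rewrite !(bilBl mB) !(bilBr mB) !(bilZl mB) !(bilZr mB) !smulA.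
rewrite !(bilBl fB) !(bilBr fB) !(bilZl fB) !(bilZr fB).
have C1 := f_cycl (smul_gr ai ai) bi bi.
have C2 := f_cycl ai ai (smul_gr bi bi).
have C3 := f_cycl (smul_gr ai bi) ai bi.
have C4 := f_anti (smul_gr ai bi) (smul_gr ai bi).
have C5 := f_anti (smul_gr (smul_gr bi bi) ai) ai.
have C6 := f_anti (smul_gr (smul_gr bi ai) bi) ai.
rewrite !smulA in C1 C2 C3 C4 C5 C6.
have XX : f (a • b) (a • b) + f (a • b) (a • b) = 0.
  by rewrite {1}C4 addbb /= expr0 scale1r addNr.
move: C1 C2 C3 C5 C6; case: i ai bi {ui uE C4} => _ _ /=;
  rewrite ?(expr0, expr1, scale1r, scaleN1r) => C1 C2 C3 C5 C6;
  rewrite C1 C2 C3 C5 C6.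
  abel.
by transitivity (- (f (a • b) (a • b) + f (a • b) (a • b)));
  [abel | rewrite XX oppr0].
Qed.
End CyclicMaps.

Local Notation AA := (tensor A A).
Local Notation "x ⊗ y" := (tens x y : AA) (at level 40, left associativity).
Local Notation tB := (@tens_bilinear _ A A).

(* V(A) is the quotient of A ⊗ A by [V_rel], and the first Milnor cyclic
   homology its quotient by [Milnor_rel]. *)
Inductive V_rel : AA -> Prop :=
| V_rel_anti i j a b : a \in gr A i -> b \in gr A j ->
    V_rel (a ⊗ b + (-1) ^+ (i && j) *: (b ⊗ a))
| V_rel_cycl i j k a b c : a \in gr A i -> b \in gr A j -> c \in gr A k ->
    V_rel ((a • b) ⊗ c - a ⊗ (b • c)
           + (-1) ^+ (k && (i (+) j)) *: ((c • a) ⊗ b)).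

Inductive Milnor_rel : AA -> Prop :=
| Milnor_rel_V x : V_rel x -> Milnor_rel x
| Milnor_rel_comm i j k a b c : a \in gr A i -> b \in gr A j -> c \in gr A k ->
    Milnor_rel (a ⊗ (b • c) - (-1) ^+ (j && k) *: (a ⊗ (c • b))).

Lemma tens_gr_eq l i j (a b : A) : a \in gr A i -> b \in gr A j ->
  i (+) j = l -> a ⊗ b \in gr AA l.
Proof. by move=> ai bj <-; exact: tens_grP. Qed.

Lemma V_rel_homog x : V_rel x -> exists i, x \in gr AA i.
Proof.
case=> {x} [i j a b ai bj|i j k a b c ai bj ck].
- exists (i (+) j); apply: rpredD; first exact: tens_grP.
  by apply: rpredZ; apply: (tens_gr_eq bj ai); rewrite addbC.
- exists (i (+) j (+) k); apply: rpredD.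
    apply: submodB; first exact: (tens_grP (smul_gr ai bj) ck).
    by apply: (tens_gr_eq ai (smul_gr bj ck)); rewrite addbA.
  by apply: rpredZ; apply: (tens_gr_eq (smul_gr ck ai) bj); rewrite -addbA addbC.
Qed.

Lemma Milnor_rel_homog x : Milnor_rel x -> exists i, x \in gr AA i.
Proof.
case=> {x} [x /V_rel_homog //|i j k a b c ai bj ck].
exists (i (+) (j (+) k)); apply: submodB.
  exact: (tens_grP ai (smul_gr bj ck)).
by apply: rpredZ; apply: (tens_gr_eq ai (smul_gr ck bj)); rewrite [k (+) j]addbC.
Qed.

Definition V_sub : gsub AA := gspan (homog_gspan V_rel_homog).
Definition Milnor_sub : gsub AA := gspan (homog_gspan Milnor_rel_homog).

Definition V_super : supermodule K := quot_super V_sub.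
Definition HC1M : supermodule K := quot_super Milnor_sub.

Definition vt (a b : A) : V_super := sqpi V_sub (a ⊗ b).

Lemma vt_bilinear : bilinear_map vt.
Proof.
split=> [b a x y|x a b c]; rewrite /vt -shZ -shD.
  by rewrite (bilDl tB) (bilZl tB).
by rewrite (bilDr tB) (bilZr tB).
Qed.
Local Notation vB := vt_bilinear.

Lemma vt_gr i j a b : a \in gr A i -> b \in gr A j ->
  vt a b \in gr V_super (i (+) j).
Proof. by move=> ai bj; apply/sh_even/tens_grP. Qed.

Lemma V_anti i j a b : a \in gr A i -> b \in gr A j ->
  vt a b = - ((-1) ^+ (i && j) *: vt b a).
Proof.
move=> ai bj; rewrite /vt -shZ -shN; apply/sqpi_eq; rewrite opprK.
exact/span_gen/V_rel_anti.
Qed.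

Lemma V_cycl i j k a b c : a \in gr A i -> b \in gr A j -> c \in gr A k ->
  vt (a • b) c = vt a (b • c) - (-1) ^+ (k && (i (+) j)) *: vt (c • a) b.
Proof.
move=> ai bj ck; rewrite /vt -shZ -shB; apply/sqpi_eq; rewrite opprB addrA addrAC.
exact/span_gen/V_rel_cycl.
Qed.

Lemma V_der i j k a b c : a \in gr A i -> b \in gr A j -> c \in gr A k ->
  vt a (sbr b c) = vt (sbr a b) c + (-1) ^+ (i && j) *: vt b (sbr a c).
Proof. exact: (cycl_der vB V_anti V_cycl). Qed.

Lemma V_alt_pure i a b : a \in gr A i -> b \in gr A i ->
  vt (sbr a b) (sbr a b) = 0.
Proof. exact: (cycl_alt vB V_anti V_cycl). Qed.

Definition mu_tens : superhom AA lieA :=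
  @stens_lift K A A lieA sbr sbr_bilinear sbr_gr.
Lemma mu_tensE a b : mu_tens (a ⊗ b) = sbr a b.
Proof. exact: stens_liftE. Qed.

Lemma mu_tens_rel x : x \in V_sub -> mu_tens x = 0.
Proof.
move: x; apply: span_ind => [|x xR|a x y _ _ x0 y0]; first exact: sh0.
  case: xR => {x} [i j a b ai bj|i j k a b c ai bj ck].
    by rewrite shD shZ !mu_tensE (sbr_anti ai bj) addNr.
  rewrite shD shZ shB !mu_tensE.
  rewrite (sbrE (smul_gr ai bj) ck) (sbrE ai (smul_gr bj ck)).
  rewrite (sbrE (smul_gr ck ai) bj) !smulA.
  by case: i j k ai bj ck => [] [] [] _ _ _ /=;
    rewrite !(expr0, expr1, scale1r, scaleN1r); abel.
by rewrite shD shZ x0 y0 scaler0 addr0.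
Qed.

Definition mu_hom : superhom V_super lieA := sqlift mu_tens_rel.
Lemma mu_vt a b : mu_hom (vt a b) = sbr a b.
Proof.
transitivity (mu_tens (a ⊗ b)); last exact: mu_tensE.
exact: (sqliftE mu_tens_rel).
Qed.

(* Bilinear extension of [a ⊗ b, a' ⊗ b'] = [a, b] ⊗ [a', b']; see [V_br_vt]. *)
Definition V_br (v w : V_super) : V_super := vt (mu_hom v) (mu_hom w).

Lemma V_br_vt a b a' b' : V_br (vt a b) (vt a' b') = vt (sbr a b) (sbr a' b').
Proof. by rewrite /V_br !mu_vt. Qed.

Lemma mu_br v w : mu_hom (V_br v w) = sbr (mu_hom v) (mu_hom w).
Proof. exact: mu_vt. Qed.

Lemma V_br_bilinear : bilinear_map V_br.
Proof.
split=> [w a v v'|v a w w']; rewrite /V_br shD shZ.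
  by rewrite (bilDl vB) (bilZl vB).
by rewrite (bilDr vB) (bilZr vB).
Qed.

Lemma V_br_gr i j v w : v \in gr V_super i -> w \in gr V_super j ->
  V_br v w \in gr V_super (i (+) j).
Proof. by move=> vi wj; apply: vt_gr; exact: sh_even. Qed.

Lemma V_br_anti i j v w : v \in gr V_super i -> w \in gr V_super j ->
  V_br v w = - ((-1) ^+ (i && j) *: V_br w v).
Proof. by move=> vi wj; apply: V_anti; exact: sh_even. Qed.

Lemma V_br_jacobi i j k u v w : u \in gr V_super i -> v \in gr V_super j ->
  w \in gr V_super k ->
  V_br u (V_br v w) = V_br (V_br u v) w + (-1) ^+ (i && j) *: V_br v (V_br u w).
Proof.
move=> ui vj wk; rewrite /V_br !mu_vt.
exact: (V_der (sh_even mu_hom ui) (sh_even mu_hom vj) (sh_even mu_hom wk)).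
Qed.


Lemma V_br_alt v : v \in gr V_super false -> V_br v v = 0.
Proof.
move=> /sqpi_surj_gr [t t0 <-]; move: t t0.
apply: span_ind => [|t' [i j a b ai bj ij]|a x y xE yE x0 y0].
- by rewrite sh0 (bil0l V_br_bilinear).
- have E : i = j by move: ij; case: (i) (j) => [] [].
  rewrite -/(vt a b) V_br_vt; rewrite -E in bj; exact: (V_alt_pure ai bj).
- rewrite shD shZ.
  rewrite !(bilDl V_br_bilinear) !(bilDr V_br_bilinear).
  rewrite !(bilZl V_br_bilinear) !(bilZr V_br_bilinear) x0 y0 !scaler0 add0r addr0.
  rewrite [V_br (sqpi V_sub y) _](V_br_anti (sh_even _ yE) (sh_even _ xE)) /=.
  by rewrite expr0 scale1r scalerN subrr.
Qed.

Definition V_lie : lieSuperalgebra K :=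
  LieSuperalgebra V_br_bilinear V_br_gr V_br_anti V_br_jacobi V_br_alt.

Definition V_mu : lie_hom V_lie lieA := @LieHom K V_lie lieA mu_hom mu_br.

(* Linear extension of ^a(x ⊗ y) = a ⊗ [x, y]; see [V_act_vt], and
   [V_act_vt_der] for the derivation form of the same action. *)
Definition V_act_fun (a : lieA) (v : V_lie) : V_lie := vt a (mu_hom v).

Lemma V_act_vt a x y : V_act_fun a (vt x y) = vt a (sbr x y).
Proof. by rewrite /V_act_fun mu_vt. Qed.

Lemma V_act_vt_der i j k a x y : a \in gr A i -> x \in gr A j -> y \in gr A k ->
  V_act_fun a (vt x y) = vt (sbr a x) y + (-1) ^+ (i && j) *: vt x (sbr a y).
Proof. by move=> ai xj yk; rewrite V_act_vt (V_der ai xj yk). Qed.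

Lemma V_act_bilinear : bilinear_map V_act_fun.
Proof.
split=> [v c a b|a c v w]; rewrite /V_act_fun ?shD ?shZ.
  by rewrite (bilDl vB) (bilZl vB).
by rewrite (bilDr vB) (bilZr vB).
Qed.

Lemma V_act_gr i j a v : a \in gr lieA i -> v \in gr V_lie j ->
  V_act_fun a v \in gr V_lie (i (+) j).
Proof. by move=> ai vj; apply: vt_gr => //; exact: sh_even. Qed.

Lemma V_der_gen i j a b c : a \in gr A i -> b \in gr A j ->
  vt a (sbr b c) = vt (sbr a b) c + (-1) ^+ (i && j) *: vt b (sbr a c).
Proof.
move=> ai bj; rewrite (comp_sum c).
rewrite !(bilDr sbr_bilinear) !(bilDr vB) !(V_der ai bj (comp_in _ c)).
by rewrite scalerDr addrACA.
Qed.

Lemma V_act_brl i j a b v : a \in gr lieA i -> b \in gr lieA j ->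
  V_act_fun (br a b) v = V_act_fun a (V_act_fun b v)
    - (-1) ^+ (i && j) *: V_act_fun b (V_act_fun a v).
Proof.
move=> ai bj; rewrite /V_act_fun !mu_vt (V_der_gen _ ai bj).
by rewrite addrK.
Qed.

Lemma V_act_brr i j a (v w : V_lie) : a \in gr lieA i -> v \in gr V_lie j ->
  V_act_fun a (br v w) = @br K V_lie (V_act_fun a v) w
    + (-1) ^+ (i && j) *: br v (V_act_fun a w).
Proof.
move=> ai vj; rewrite /V_act_fun /= /V_br !mu_vt.
exact: (V_der_gen _ ai (sh_even mu_hom vj)).
Qed.

Definition V_act : lie_action lieA V_lie :=
  @LieAction K lieA V_lie V_act_fun V_act_bilinear V_act_gr V_act_brl V_act_brr.

Definition V_xmod : crossed_module lieA :=
  @CrossedModule K lieA V_lie V_mu V_act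
    (fun a v => mu_vt a (mu_hom v)) (fun _ _ => erefl).

Lemma mu_in_commA v : mu_hom v \in commA.
Proof.
have [t <-] := sqpi_surj v; rewrite (sqliftE mu_tens_rel).
elim/tens_ind: t => [|a x y t IH]; first by rewrite sh0 rpred0.
by rewrite shD shZ mu_tensE rpredD ?rpredZ //; exact: brspanP.
Qed.

Definition V_comm : superhom V_super (sub_super commA) := corestr mu_in_commA.

Definition HC1 : supermodule K := sub_super (ker V_comm).

(* A / [A, A] *)
Definition Acomm : supermodule K := quot_super commA.

(* [A, A] / [A, [A, A]] *)
Definition comm_quot : supermodule K :=
  quot_super (gpreim (sub_incl commA) (brspan (gfull lieA) commA)).
End SuperalgebraConstructions.

Definition exact_at (K : comPzRingType) (M N P : supermodule K)
    (f : superhom M N) (g : superhom N P) :=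
  forall y, g y = 0 <-> exists x, f x = y.

(* Main.v *)
(* Tensoring 0 -> HC_1(A) -> V(A) -> [A,A] -> 0 with A gives the right exact
   sequence A/[A,A] ⊗ HC_1(A) -> A ⊗ V(A) -> A ⊗ [A,A] -> 0, because A acts
   trivially on HC_1(A); the theorem is the snake lemma for the maps ν from it
   to the original sequence.  The connecting map is explicit: ν on A ⊗ V(A)
   factors through the Lie homomorphism θ : A ⊗ [A,A] -> V(A) sending a ⊗ u to
   the class of a ⊗ u, and the kernel of V(A) -> HC_1^M(A) is the image of θ. *)
From HB Require Import structures.
From mathcomp Require Import all_boot all_algebra.
From mathcomp Require Import boolp.
Require Import Defs.

Set Implicit Arguments.
Unset Strict Implicit.
Unset Printing Implicit Defensive.

Import GRing.Theory.
Local Open Scope ring_scope.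

(** * Composition and descent of bilinear maps *)

Section Linear.
Variable K : comPzRingType.

Definition shcomp (M N P : supermodule K) (g : superhom N P) (f : superhom M N) :
  superhom M P :=
  @Superhom K M P (g \o f : {linear M -> P})
    (fun i x xi => sh_even g (sh_even f xi)).

Lemma bilinear_mapI (M N P : lmodType K) (f : M -> N -> P) :
  (forall a m m' n, f (a *: m + m') n = a *: f m n + f m' n) ->
  (forall a m n n', f m (a *: n + n') = a *: f m n + f m n') -> bilinear_map f.
Proof. by move=> fl fr; split=> [n a m m'|m a n n']; rewrite ?fl ?fr. Qed.

Lemma bilinear_flip (M N P : lmodType K) (f : M -> N -> P) :
  bilinear_map f -> bilinear_map (fun n m => f m n).
Proof. by case. Qed.

(** The descended map evaluates [f] at a chosen preimage. The choice [r] is not linear, but [f n] is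
    constant on the fibres of [g] because it vanishes on the kernel, and this gives bilinearity. *)
Lemma bilinear_descent (M M' N P : supermodule K) (g : superhom M M')
    (f : N -> M -> P) :
    (forall y, exists x, g x = y) -> bilinear_map f ->
    (forall i j n m, n \in gr N i -> m \in gr M j -> f n m \in gr P (i (+) j)) ->
    (forall n m, g m = 0 -> f n m = 0) ->
  exists h : N -> M' -> P,
    [/\ bilinear_map h,
        forall i j n m, n \in gr N i -> m \in gr M' j -> h n m \in gr P (i (+) j)
      & forall n m, h n (g m) = f n m].
Proof.
move=> gs fB fgr f0; pose r y := sval (cid (gs y)).
have gr_ y : g (r y) = y by rewrite /r; case: cid.
have fE n x y : g x = g y -> f n x = f n y.
  move=> E; apply/eqP; rewrite -subr_eq0 -(bilBr fB); apply/eqP/f0.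
  by rewrite shB E subrr.
exists (fun n y => f n (r y)); split.
- apply: bilinear_mapI => [a m m' n|a m n n'].
    by rewrite (bilDl fB) (bilZl fB).
  rewrite -(bilZr fB) -(bilDr fB); apply: fE.
  by rewrite shD shZ !gr_.
- move=> i j n m ni mj.
  (* The chosen preimage of a homogeneous [m] need not be homogeneous; its component of degree [j]
     is also a preimage, as [g] is even. *)
  have -> : f n (r m) = f n (comp j (r m)).
    by apply: fE; rewrite -comp_hom !gr_ (comp_id _ mj) eqxx.
  exact/fgr/comp_in.
- by move=> n m; apply: fE; rewrite gr_.
Qed.
End Linear.

(** * Calculus in the non-abelian tensor product *)

Section NonabelianTensorTheory.
Variables (K : comPzRingType) (M N : lieSuperalgebra K).
Variables (aM : lie_action M N) (aN : lie_action N M).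
Local Notation T := (natensor aM aN).
Local Notation nt := (naten aM aN).

(** A symbol carries proofs of the degrees of its factors, which obstruct rewriting; those proofs
    are unique, being equalities of booleans. *)
Lemma naten_congr i j m m' n n' (mP : m \in gr M i) (nP : n \in gr N j)
    (mP' : m' \in gr M i) (nP' : n' \in gr N j) :
  m = m' -> n = n' -> nt mP nP = nt mP' nP'.
Proof.
move=> mE nE; case: m' / mE in mP' *; case: n' / nE in nP' *.
by rewrite (bool_irrelevance mP mP') (bool_irrelevance nP nP').
Qed.

Lemma natenZl a i j m n (mP : m \in gr M i) (nP : n \in gr N j) :
  nt (rpredZ a mP) nP = a *: nt mP nP.
Proof.
apply/esym/eqP; rewrite -subr_eq0; apply/eqP.
by have := pres_rel (@natens_rel_homog _ _ _ aM aN) (nt_scalel aM aN a mP nP);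
  rewrite shB shZ.
Qed.

Lemma natenZr a i j m n (mP : m \in gr M i) (nP : n \in gr N j) :
  nt mP (rpredZ a nP) = a *: nt mP nP.
Proof.
apply/esym/eqP; rewrite -subr_eq0; apply/eqP.
by have := pres_rel (@natens_rel_homog _ _ _ aM aN) (nt_scaler aM aN a mP nP);
  rewrite shB shZ.
Qed.

Lemma natenDl i j m m' n (mP : m \in gr M i) (mP' : m' \in gr M i)
    (nP : n \in gr N j) :
  nt (rpredD mP mP') nP = nt mP nP + nt mP' nP.
Proof.
apply/eqP; rewrite -subr_eq0; apply/eqP.
by have := pres_rel (@natens_rel_homog _ _ _ aM aN) (nt_addl aM aN mP mP' nP);
  rewrite shB shD.
Qed.

Lemma natenDr i j m n n' (mP : m \in gr M i) (nP : n \in gr N j)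
    (nP' : n' \in gr N j) :
  nt mP (rpredD nP nP') = nt mP nP + nt mP nP'.
Proof.
apply/eqP; rewrite -subr_eq0; apply/eqP.
by have := pres_rel (@natens_rel_homog _ _ _ aM aN) (nt_addr aM aN mP nP nP');
  rewrite shB shD.
Qed.

Lemma naten0l i j m n (mP : m \in gr M i) (nP : n \in gr N j) :
  m = 0 -> nt mP nP = 0.
Proof.
move=> m0; rewrite -(scale0r (nt mP nP)) -natenZl; apply: naten_congr => //.
by rewrite m0 scaler0.
Qed.

Lemma naten0r i j m n (mP : m \in gr M i) (nP : n \in gr N j) :
  n = 0 -> nt mP nP = 0.
Proof.
move=> n0; rewrite -(scale0r (nt mP nP)) -natenZr; apply: naten_congr => //.
by rewrite n0 scaler0.
Qed.

(* The symbol m ⊗ n of the presentation, extended bilinearly from homogeneous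
   elements to all of M × N. *)
Definition ntens (m : M) (n : N) : T :=
  \sum_(i : bool) \sum_(j : bool) nt (comp_in i m) (comp_in j n).

Lemma ntens_bilinear : bilinear_map ntens.
Proof.
apply: bilinear_mapI => [a m m' n|a m n n']; rewrite /ntens !scaler_sumr;
  rewrite -big_split; apply: eq_bigr => i _ /=;
  rewrite scaler_sumr -big_split; apply: eq_bigr => j _ /=.
  rewrite -natenZl -natenDl; apply: naten_congr => //.
  by rewrite compD compZ.
rewrite -natenZr -natenDr; apply: naten_congr => //.
by rewrite compD compZ.
Qed.
Local Notation tB := ntens_bilinear.

(** For homogeneous factors, every summand of [ntens] except that of degrees [i], [j] has a zero
    factor. *)
Lemma ntensE i j m n (mP : m \in gr M i) (nP : n \in gr N j) :
  nt mP nP = ntens m n.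
Proof.
have mC k := comp_id k mP; have nC k := comp_id k nP.
rewrite /ntens (bigD1 i) //= (bigD1 j) //= !big1 ?addr0.
- by apply: naten_congr; rewrite ?mC ?nC eqxx.
- move=> k /negPf ki; rewrite big1 // => l _; apply: naten0l.
  by rewrite mC ki.
- by move=> k /negPf ki; apply: naten0r; rewrite nC ki.
Qed.

Lemma ntens_gr i j m n : m \in gr M i -> n \in gr N j ->
  ntens m n \in gr T (i (+) j).
Proof.
move=> mP nP; rewrite -(ntensE mP nP).
exact: (pgen_gr (@natens_rel_homog _ _ _ aM aN) (TSym mP nP)).
Qed.

Lemma ntens_brl i i' j m m' n : m \in gr M i -> m' \in gr M i' -> n \in gr N j ->
  ntens (br m m') n
  = ntens m (aM m' n) - (-1) ^+ (i && i') *: ntens m' (aM m n).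
Proof.
move=> mP mP' nP; rewrite -(ntensE (br_gr mP mP') nP).
rewrite -(ntensE mP (act_gr aM mP' nP)) -(ntensE mP' (act_gr aM mP nP)).
apply/eqP; rewrite -subr_eq0; apply/eqP.
by have := pres_rel (@natens_rel_homog _ _ _ aM aN) (nt_brl aM aN mP mP' nP);
  rewrite !shB !shZ.
Qed.

Lemma ntens_brr i j j' m n n' : m \in gr M i -> n \in gr N j -> n' \in gr N j' ->
  ntens m (br n n')
  = (-1) ^+ (j' && (i (+) j)) *: ntens (aN n' m) n
    - (-1) ^+ (i && j) *: ntens (aN n m) n'.
Proof.
move=> mP nP nP'; rewrite -(ntensE mP (br_gr nP nP')).
rewrite -(ntensE (act_gr aN nP' mP) nP) -(ntensE (act_gr aN nP mP) nP').
apply/eqP; rewrite -subr_eq0; apply/eqP.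
by have := pres_rel (@natens_rel_homog _ _ _ aM aN) (nt_brr aM aN mP nP nP');
  rewrite !shB !shZ.
Qed.

Lemma ntens_br i j i' j' m n m' n' : m \in gr M i -> n \in gr N j ->
  m' \in gr M i' -> n' \in gr N j' ->
  br (ntens m n) (ntens m' n')
  = - ((-1) ^+ (i && j) *: ntens (aN n m) (aM m' n')).
Proof.
move=> mP nP mP' nP'.
rewrite -(ntensE mP nP) -(ntensE mP' nP').
rewrite -(ntensE (act_gr aN nP mP) (act_gr aM mP' nP')).
apply/eqP; rewrite -subr_eq0 opprK; apply/eqP.
have := pres_rel (@natens_rel_homog _ _ _ aM aN) (nt_br aM aN mP nP mP' nP').
by rewrite shD shZ /= -pres_brE.
Qed.

(** The symbols generate [T] as a Lie superalgebra, but they already span it as a module: by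
    relation (iv) a bracket of two symbols is again a symbol, so each non-associative monomial
    collapses to one symbol. *)
Lemma ntens_ind (Q : T -> Prop) :
  Q 0 -> (forall a m n z, Q z -> Q (a *: ntens m n + z)) -> forall z, Q z.
Proof.
move=> Q0 QS z.
have [x <-] := sqpi_surj z.
elim/freemod_ind: x => [|a t x IH]; first by rewrite sh0.
suff [i [j [m [n [mP nP E]]]]] : exists i j m n,
    [/\ m \in gr M i, n \in gr N j &
      sqpi (lie_gideal (@natens_rel_homog _ _ _ aM aN)) (fdelta t) = ntens m n].
  by rewrite shD shZ E; exact: QS.
elim: t {IH} => [[i j m n mP nP]|s [i [j [m [n [mP nP E]]]]] t
    [i' [j' [m' [n' [mP' nP' E']]]]]].
  by exists i, j, m, n; split; rewrite -?(ntensE mP nP).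
rewrite -fmul_delta -pres_brE E E'.
(* The witnesses are the factors in relation (iv), with its sign moved into the first one. *)
exists (j (+) i), (i' (+) j'), (- ((-1) ^+ (i && j) *: aN n m)), (aM m' n').
split; [exact/submodN/rpredZ/act_gr | exact: act_gr |].
by rewrite (bilNl tB) (bilZl tB); exact: (ntens_br mP nP mP' nP').
Qed.

Section Lift.
Variables (L : lieSuperalgebra K) (F : M -> N -> L) (FB : bilinear_map F).
Hypothesis F_gr : forall i j m n, m \in gr M i -> n \in gr N j ->
  F m n \in gr L (i (+) j).
Hypothesis F_brl : forall i i' j m m' n,
  m \in gr M i -> m' \in gr M i' -> n \in gr N j ->
  F (br m m') n = F m (aM m' n) - (-1) ^+ (i && i') *: F m' (aM m n).
Hypothesis F_brr : forall i j j' m n n',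
  m \in gr M i -> n \in gr N j -> n' \in gr N j' ->
  F m (br n n') = (-1) ^+ (j' && (i (+) j)) *: F (aN n' m) n
                  - (-1) ^+ (i && j) *: F (aN n m) n'.
Hypothesis F_br : forall i j i' j' m n m' n',
  m \in gr M i -> n \in gr N j -> m' \in gr M i' -> n' \in gr N j' ->
  br (F m n) (F m' n') = - ((-1) ^+ (i && j) *: F (aN n m) (aM m' n')).

Definition lift_sym (s : tsym M N) : L := F (ts_m s) (ts_n s).

Lemma lift_sym_gr s : lift_sym s \in gr L (ts_deg s).
Proof. by case: s => i j m n mP nP; exact: F_gr. Qed.

Lemma lift_sym_rel x : natens_rel aM aN x -> mext lift_sym_gr x = 0.
Proof.
have gE i j m n (mP : m \in gr M i) (nP : n \in gr N j) :
  mext lift_sym_gr (tsym_gen mP nP) = F m n by exact: mext_gen.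
case=> {x} [a i j m n mP nP|a i j m n mP nP|i j m m' n mP mP' nP
  |i j m n n' mP nP nP'|i i' j m m' n mP mP' nP|i j j' m n n' mP nP nP'
  |i j i' j' m n m' n' mP nP mP' nP'].
- by rewrite shB shZ !gE (bilZl FB) subrr.
- by rewrite shB shZ !gE (bilZr FB) subrr.
- by rewrite shB shD !gE (bilDl FB) subrr.
- by rewrite shB shD !gE (bilDr FB) subrr.
- by rewrite !shB shZ !gE (F_brl mP mP' nP) subrr.
- by rewrite !shB !shZ !gE (F_brr mP nP nP') subrr.
- by rewrite shD shZ mext_fmul !gE (F_br mP nP mP' nP') addNr.
Qed.

(** The universal property: relations (i) and (ii) hold in [L] by bilinearity of [F], relations
    (iii) and (iv) by the hypotheses on [F]. *)
Definition ntens_lift : lie_hom T L :=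
  pres_lift (@natens_rel_homog _ _ _ _ _) lift_sym_rel.

Lemma ntens_liftE m n : ntens_lift (ntens m n) = F m n.
Proof.
elim/homog_ind: m => [m m'|i m mP]; first by
  rewrite (bilDl tB) (bilDl FB) shD => -> ->.
elim/homog_ind: n => [n n'|j n nP]; first by
  rewrite (bilDr tB) (bilDr FB) shD => -> ->.
by rewrite -(ntensE mP nP); exact: pres_liftE.
Qed.
End Lift.
End NonabelianTensorTheory.

(** * Quotients of Lie superalgebras by graded ideals *)

Section LieQuotient.
Variables (K : comPzRingType) (L : lieSuperalgebra K) (I : gsub L).
Hypothesis Iideal : forall x y, y \in I -> br x y \in I.
Local Notation bB := (@br_bilinear _ L).
Local Notation Q := (quot_super I).
Local Notation qp := (sqpi I).

(** Since [I] is graded, the two sides of the bracket can be exchanged by antisymmetry on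
    homogeneous components. *)
Lemma ideal_brl x y : x \in I -> br x y \in I.
Proof.
move=> xI; rewrite (comp_sum x) (comp_sum y) !(bilDl bB) !(bilDr bB).
have H i j : br (comp i x) (comp j y) \in I.
  rewrite (br_anti (comp_in i x) (comp_in j y)).
  exact/submodN/rpredZ/Iideal/gsubP.
by rewrite !rpredD.
Qed.

Definition quot_br (p q : Q) : Q :=
  qp (br (sval (cid (sqpi_surj p))) (sval (cid (sqpi_surj q)))).

Lemma quot_brE x y : quot_br (qp x) (qp y) = qp (br x y).
Proof.
rewrite /quot_br; case: cid => x' /= /sqpi_eq xE; case: cid => y' /= /sqpi_eq yE.
apply/sqpi_eq; rewrite (_ : _ - _ = br x' (y' - y) + br (x' - x) y).
  by apply: rpredD; [exact: Iideal | exact: ideal_brl].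
by rewrite (bilBl bB) (bilBr bB); abel.
Qed.

Lemma quot_br_bilinear : bilinear_map quot_br.
Proof.
apply: bilinear_mapI => a p q r; have [x <-] := sqpi_surj p;
  have [y <-] := sqpi_surj q; have [z <-] := sqpi_surj r.
  by rewrite -shZ -shD !quot_brE (bilDl bB) (bilZl bB) shD shZ.
by rewrite -shZ -shD !quot_brE (bilDr bB) (bilZr bB) shD shZ.
Qed.

Lemma quot_br_gr i j p q : p \in gr Q i -> q \in gr Q j ->
  quot_br p q \in gr Q (i (+) j).
Proof.
move=> /sqpi_surj_gr [x xi <-] /sqpi_surj_gr [y yj <-].
by rewrite quot_brE; apply/sh_even/br_gr.
Qed.

Lemma quot_br_anti i j p q : p \in gr Q i -> q \in gr Q j ->
  quot_br p q = - ((-1) ^+ (i && j) *: quot_br q p).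
Proof.
move=> /sqpi_surj_gr [x xi <-] /sqpi_surj_gr [y yj <-].
by rewrite !quot_brE (br_anti xi yj) shN shZ.
Qed.

Lemma quot_br_jacobi i j k p q r :
  p \in gr Q i -> q \in gr Q j -> r \in gr Q k ->
  quot_br p (quot_br q r)
  = quot_br (quot_br p q) r + (-1) ^+ (i && j) *: quot_br q (quot_br p r).
Proof.
move=> /sqpi_surj_gr [x xi <-] /sqpi_surj_gr [y yj <-] /sqpi_surj_gr [z zk <-].
by rewrite !quot_brE (br_jacobi xi yj zk) shD shZ.
Qed.

Lemma quot_br_alt p : p \in gr Q false -> quot_br p p = 0.
Proof. by move=> /sqpi_surj_gr [x x0 <-]; rewrite quot_brE (br_alt x0) sh0. Qed.

Definition quot_lie : lieSuperalgebra K :=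
  LieSuperalgebra quot_br_bilinear quot_br_gr quot_br_anti quot_br_jacobi
    quot_br_alt.
End LieQuotient.

(** * Images as graded submodules *)

Section ImageSuper.
Variables (K : comPzRingType) (M N : supermodule K) (f : superhom M N).

Definition im_pred : {pred N} := fun y => `[< exists x, f x = y >].
Lemma im_subproof : submod_closed im_pred.
Proof.
split; first by apply/asboolP; exists 0; rewrite sh0.
move=> a _ _ /asboolP [x <-] /asboolP [y <-]; apply/asboolP.
by exists (a *: x + y); rewrite shD shZ.
Qed.
HB.instance Definition _ :=
  GRing.isSubmodClosed.Build K N im_pred im_subproof.
Lemma im_comp i y : y \in im_pred -> comp i y \in im_pred.
Proof.
by move=> /asboolP [x <-]; apply/asboolP; exists (comp i x); rewrite comp_hom.
Qed.
Definition im : gsub N := GSub im_comp.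
Lemma imP y : reflect (exists x, f x = y) (y \in im).
Proof. exact: asboolP. Qed.
End ImageSuper.

(** * The tensor product of a Lie superalgebra with a crossed module over it *)

Section XmodTensor.
Variables (K : comPzRingType) (P : lieSuperalgebra K) (X : crossed_module P).

Definition xm_tens (p : P) (m : X) : xm_tensor X :=
  ntens (xm_act X) (xm_back X) p m.

Lemma xm_tens_bilinear : bilinear_map xm_tens.
Proof. exact: ntens_bilinear. Qed.
Local Notation tB := xm_tens_bilinear.

Lemma xm_tensor_ind (R : xm_tensor X -> Prop) :
  R 0 -> (forall a p m z, R z -> R (a *: xm_tens p m + z)) -> forall z, R z.
Proof. exact: ntens_ind. Qed.

Lemma xm_nu_tens p m : xm_nu X (xm_tens p m) = xm_act X p m.
Proof.
have aB := act_bilinear (xm_act X).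
elim/homog_ind: p => [p p'|i p pP]; first by
  rewrite (bilDl tB) (bilDl aB) shD => -> ->.
elim/homog_ind: m => [m m'|j m mP]; first by
  rewrite (bilDr tB) (bilDr aB) shD => -> ->.
by rewrite /xm_tens -(ntensE _ _ pP mP); exact: xm_nuE.
Qed.

(** The bracket depends on its arguments only through ν, so the kernel of ν is central. *)
Lemma xm_tens_br z w :
  br z w = xm_tens (xm_bd X (xm_nu X z)) (xm_nu X w).
Proof.
have bB := @br_bilinear _ (xm_tensor X).
have aB := act_bilinear (xm_act X).
elim/xm_tensor_ind: z => [|a p m z IH]; first by
  rewrite (bil0l bB) !sh0 (bil0l tB).
rewrite (bilDl bB) (bilZl bB) !shD !shZ (bilDl tB) (bilZl tB) IH.
congr (a *: _ + _) => {a z IH}.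
rewrite xm_nu_tens xm_bd_act.
elim/xm_tensor_ind: w => [|a p' m' w IH]; first by
  rewrite (bil0r bB) !sh0 (bil0r tB).
rewrite (bilDr bB) (bilZr bB) !shD !shZ (bilDr tB) (bilZr tB) IH.
congr (a *: _ + _) => {a w IH}; rewrite xm_nu_tens.
have pB := @br_bilinear _ P.
elim/homog_ind: p => [p q|i p pP]; first by
  rewrite (bilDl tB) (bilDl bB) (bilDl pB) (bilDl tB) => -> ->.
elim/homog_ind: m => [m n|j m mP]; first by
  rewrite (bilDr tB) (bilDl bB) shD (bilDr pB) (bilDl tB) => -> ->.
elim/homog_ind: p' => [p' q|i' p' pP']; first by
  rewrite (bilDl tB) (bilDr bB) (bilDl aB) (bilDr tB) => -> ->.
elim/homog_ind: m' => [m' n|j' m' mP']; first by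
  rewrite (bilDr tB) (bilDr bB) (bilDr aB) (bilDr tB) => -> ->.
(* Relation (iv) involves [[∂ m, p]]; antisymmetry turns it into [[p, ∂ m]] and absorbs the sign. *)
rewrite /xm_tens (ntens_br _ _ pP mP pP' mP') (br_anti pP (sh_even (xm_bd X) mP)).
by rewrite (bilNl (ntens_bilinear _ _)) (bilZl (ntens_bilinear _ _)) andbC.
Qed.

Lemma xm_tens_brl i j p q m : p \in gr P i -> q \in gr P j ->
  xm_tens (br p q) m
  = xm_tens p (xm_act X q m) - (-1) ^+ (i && j) *: xm_tens q (xm_act X p m).
Proof.
move=> pP qP; have aB := act_bilinear (xm_act X).
elim/homog_ind: m => [m m'|k m mP]; last exact: ntens_brl pP qP mP.
by rewrite !(bilDr aB) !(bilDr tB) => -> ->; rewrite scalerDr; abel.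
Qed.

(** Relation (iii) writes [[p, q] ⊗ m] in terms of the actions of [p] and [q] on [m], both zero
    here. This is what lets the factor [A] be replaced by [A/[A,A]] when tensoring with
    [HC_1(A)]. *)
Lemma xm_tens_comm0 p m :
  (forall q, xm_act X q m = 0) ->
  p \in brspan (@gfull _ P) (@gfull _ P) -> xm_tens p m = 0.
Proof.
move=> m0; move: p; apply: span_ind => [|_ [p q _ _]|a x y _ _ x0 y0].
- exact: (bil0l tB).
- have pB := @br_bilinear _ P.
  elim/homog_ind: p => [p p'|i p pP]; first by
    rewrite (bilDl pB) (bilDl tB) => -> ->; rewrite addr0.
  elim/homog_ind: q => [q q'|j q qP]; first by
    rewrite (bilDr pB) (bilDl tB) => -> ->; rewrite addr0.
  by rewrite (xm_tens_brl _ pP qP) !m0 !(bil0r tB) scaler0 subr0.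
- by rewrite (bilDl tB) (bilZl tB) x0 y0 scaler0 addr0.
Qed.
End XmodTensor.

(** * Functoriality and right exactness of [P ⊗ -] *)

Section XmodMorphism.
Variables (K : comPzRingType) (P : lieSuperalgebra K) (X Y : crossed_module P).
Variable f : lie_hom X Y.
Hypothesis f_act : forall p x, f (xm_act X p x) = xm_act Y p (f x).
Hypothesis f_bd : forall x, xm_bd Y (f x) = xm_bd X x.

Definition xm_tensor_fun (p : P) (x : X) : xm_tensor Y := xm_tens p (f x).
Local Notation tB := (xm_tens_bilinear Y).

Lemma xm_tensor_fun_bilinear : bilinear_map xm_tensor_fun.
Proof.
apply: bilinear_mapI => [a p p' m|a p m m']; rewrite /xm_tensor_fun.
  by rewrite (bilDl tB) (bilZl tB).
by rewrite shD shZ (bilDr tB) (bilZr tB).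
Qed.

Lemma xm_tensor_fun_gr i j p x : p \in gr P i -> x \in gr X j ->
  xm_tensor_fun p x \in gr (xm_tensor Y) (i (+) j).
Proof. by move=> pP xP; apply: ntens_gr => //; exact: sh_even. Qed.

Lemma xm_tensor_fun_brl i i' j p p' x :
  p \in gr P i -> p' \in gr P i' -> x \in gr X j ->
  xm_tensor_fun (br p p') x = xm_tensor_fun p (xm_act X p' x)
    - (-1) ^+ (i && i') *: xm_tensor_fun p' (xm_act X p x).
Proof.
by move=> pP pP' xP; rewrite /xm_tensor_fun !f_act; exact: xm_tens_brl.
Qed.

Lemma xm_back_natural x p : xm_back Y (f x) p = xm_back X x p.
Proof. by rewrite /= /xm_back_fun f_bd. Qed.

Lemma xm_tensor_fun_brr i j j' p x x' :
  p \in gr P i -> x \in gr X j -> x' \in gr X j' ->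
  xm_tensor_fun p (br x x')
  = (-1) ^+ (j' && (i (+) j)) *: xm_tensor_fun (xm_back X x' p) x
    - (-1) ^+ (i && j) *: xm_tensor_fun (xm_back X x p) x'.
Proof.
move=> pP xP xP'; rewrite /xm_tensor_fun lh_br -!xm_back_natural.
exact: (ntens_brr _ _ pP (sh_even f xP) (sh_even f xP')).
Qed.

Lemma xm_tensor_fun_br i j i' j' p x p' x' :
  p \in gr P i -> x \in gr X j -> p' \in gr P i' -> x' \in gr X j' ->
  br (xm_tensor_fun p x) (xm_tensor_fun p' x')
  = - ((-1) ^+ (i && j) *:
        xm_tensor_fun (xm_back X x p) (xm_act X p' x')).
Proof.
move=> pP xP pP' xP'; rewrite /xm_tensor_fun f_act -xm_back_natural.
exact: (ntens_br _ _ pP (sh_even f xP) pP' (sh_even f xP')).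
Qed.

(** The map [P ⊗ f]. Its relations are those of [P ⊗ Y], transported by compatibility of [f] with
    the actions in both directions. *)
Definition xm_tensor_map : lie_hom (xm_tensor X) (xm_tensor Y) :=
  ntens_lift xm_tensor_fun_bilinear xm_tensor_fun_gr xm_tensor_fun_brl
    xm_tensor_fun_brr xm_tensor_fun_br.

Lemma xm_tensor_mapE p x : xm_tensor_map (xm_tens p x) = xm_tens p (f x).
Proof. exact: ntens_liftE. Qed.

Lemma xm_nu_natural z : xm_nu Y (xm_tensor_map z) = f (xm_nu X z).
Proof.
elim/xm_tensor_ind: z => [|a p x z IH]; first by rewrite !sh0.
rewrite (shD xm_tensor_map) (shZ xm_tensor_map) xm_tensor_mapE.
by rewrite !(shD (xm_nu _)) !(shZ (xm_nu _)) IH !xm_nu_tens -f_act shD shZ.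
Qed.

Hypothesis f_surj : forall y, exists x, f x = y.

Lemma xm_tensor_map_surj w : exists z, xm_tensor_map z = w.
Proof.
elim/xm_tensor_ind: w => [|a p y w [z <-]]; first by exists 0; rewrite sh0.
have [x <-] := f_surj y; exists (a *: xm_tens p x + z).
by rewrite shD shZ xm_tensor_mapE.
Qed.

(** As [f] is even, the component of degree [i] of any preimage is a preimage. *)
Lemma homog_lift i y : y \in gr Y i -> exists2 x, x \in gr X i & f x = y.
Proof.
move=> yP; have [x xE] := f_surj y; exists (comp i x); first exact: comp_in.
by rewrite -comp_hom xE (comp_id _ yP) eqxx.
Qed.

(* Right exactness of P ⊗ -: lifting the second factor inverts the map
   (P ⊗ X) / S -> P ⊗ Y, where S is central because it is killed by ν. *)
Lemma xm_tensor_map_ker (S : gsub (xm_tensor X)) :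
    (forall p x, f x = 0 -> xm_tens p x \in S) ->
    (forall s, s \in S -> xm_nu X s = 0) ->
  forall z, xm_tensor_map z = 0 -> z \in S.
Proof.
move=> S_ker S_nu.
have Sid z s : s \in S -> br z s \in S.
  by move=> /S_nu s0; rewrite xm_tens_br s0 (bil0r (xm_tens_bilinear X)) rpred0.
have qB : bilinear_map (fun p x => sqpi S (xm_tens p x)).
  apply: bilinear_mapI => [a p p' m|a p m m']; rewrite -shZ -shD.
    by rewrite (bilDl (xm_tens_bilinear X)) (bilZl (xm_tens_bilinear X)).
  by rewrite (bilDr (xm_tens_bilinear X)) (bilZr (xm_tens_bilinear X)).
have [||g [gB g_gr gE]] := bilinear_descent (g := f) f_surj qB.
- by move=> i j p x pP xP; apply/sh_even/ntens_gr.
- by move=> p x /(S_ker p) xS; apply/sqpi0.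
pose Q := quot_lie Sid.
(* Each relation for [g] is checked on homogeneous lifts to [X], where it is a relation of [P ⊗ X]
   reduced modulo [S]. *)
have g_brl i i' j p p' y : p \in gr P i -> p' \in gr P i' -> y \in gr Y j ->
    g (br p p') y = g p (xm_act Y p' y)
      - (-1) ^+ (i && i') *: g p' (xm_act Y p y).
  move=> pP pP' /homog_lift [x xP <-].
  by rewrite -!f_act !gE (xm_tens_brl _ pP pP') shB shZ.
have g_brr i j j' p y y' : p \in gr P i -> y \in gr Y j -> y' \in gr Y j' ->
    g p (br y y') = (-1) ^+ (j' && (i (+) j)) *: g (xm_back Y y' p) y
      - (-1) ^+ (i && j) *: g (xm_back Y y p) y'.
  move=> pP /homog_lift [x xP <-] /homog_lift [x' xP' <-].
  by rewrite !xm_back_natural -lh_br !gE /xm_tens (ntens_brr _ _ pP xP xP') shB !shZ.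
have g_br i j i' j' p y p' y' : p \in gr P i -> y \in gr Y j ->
    p' \in gr P i' -> y' \in gr Y j' ->
    br (g p y : Q) (g p' y' : Q)
    = - ((-1) ^+ (i && j) *: g (xm_back Y y p) (xm_act Y p' y')).
  move=> pP /homog_lift [x xP <-] pP' /homog_lift [x' xP' <-].
  rewrite xm_back_natural -f_act !gE -[br _ _]/(quot_br _ _) quot_brE //.
  by rewrite /xm_tens (ntens_br _ _ pP xP pP' xP') shN shZ.
pose psi : lie_hom (xm_tensor Y) Q :=
    @ntens_lift K P Y (xm_act Y) (xm_back Y) Q g gB g_gr g_brl g_brr g_br.
have psiE z : psi (xm_tensor_map z) = sqpi S z.
  elim/xm_tensor_ind: z => [|a p x z IH]; first by rewrite !sh0.
  rewrite (shD xm_tensor_map) (shZ xm_tensor_map) xm_tensor_mapE.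
  rewrite (shD psi) (shZ psi) IH (shD (sqpi S)) (shZ (sqpi S)) -gE.
  by congr (_ *: _ + _); exact: ntens_liftE.
by move=> z z0; apply/sqpi0; rewrite -psiE z0 sh0.
Qed.
End XmodMorphism.

(** * The crossed modules [V(A)] and [[A,A]] and the maps of the sequence *)

Section CyclicSequence.
Variables (K : comPzRingType) (A : superalgebra K).
Local Notation VX := (V_xmod A).
Local Notation CX := (comm_xmod A).
Local Notation vB := (@vt_bilinear K A).
Local Notation sB := (@sbr_bilinear K A).

Lemma V_comm_br v w :
  V_comm A (br (v : VX) w) = br (V_comm A v : CX) (V_comm A w).
Proof. by apply: sub_val_inj; exact: mu_br. Qed.

Definition V_comm_hom : lie_hom VX CX := @LieHom K VX CX (V_comm A) V_comm_br.

Lemma V_comm_act a v : V_comm_hom (xm_act VX a v) = xm_act CX a (V_comm_hom v).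
Proof. by apply: sub_val_inj; exact: mu_vt. Qed.

Lemma V_comm_bd v : xm_bd CX (V_comm_hom v) = xm_bd VX v.
Proof. by []. Qed.

Lemma V_comm_surj u : exists v, V_comm_hom v = u.
Proof.
suff H x : x \in commA A -> exists v, mu_hom A v = x.
  have [v vE] := H _ (sub_valP u); exists v; exact: sub_val_inj.
move: x; apply: span_ind => [|_ [a b _ _]|c x y _ _ [v <-] [w <-]].
- by exists 0; rewrite sh0.
- by exists (vt a b); exact: mu_vt.
- by exists (c *: v + w); rewrite shD shZ.
Qed.

Lemma V_comm_eq0 v : (V_comm A v = 0) <-> (mu_hom A v = 0).
Proof.
split=> [E|E]; last exact: sub_val_inj.
by rewrite -[mu_hom A v]/(sub_val (V_comm A v)) E.
Qed.

(** The functor [A ⊗ -] applied to [V(A) → [A,A]]; its restriction to the kernels of ν is the second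
    map of the sequence. *)
Definition tensor_comm : lie_hom (xm_tensor VX) (xm_tensor CX) :=
  xm_tensor_map V_comm_act V_comm_bd.

Lemma tensor_commE a v :
  tensor_comm (xm_tens a v) = xm_tens (X := CX) a (V_comm_hom v).
Proof. exact: xm_tensor_mapE. Qed.

(* The snake lemma connecting map H_1(A, [A,A]) -> HC_1(A) is the restriction
   of the Lie map A ⊗ [A,A] -> V(A), a ⊗ u |-> class of a ⊗ u. *)
Definition theta_fun (a : lieA A) (u : ideal_lie (@commA_ideal K A)) : V_lie A :=
  vt a (sub_val u).

Lemma theta_fun_bilinear : bilinear_map theta_fun.
Proof.
apply: bilinear_mapI => [c a b u|c a u w]; rewrite /theta_fun.
  by rewrite (bilDl vB) (bilZl vB).
by rewrite sub_valD sub_valZ (bilDr vB) (bilZr vB).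
Qed.

Lemma theta_fun_gr i j a u : a \in gr (lieA A) i ->
  u \in gr (ideal_lie (@commA_ideal K A)) j ->
  theta_fun a u \in gr (V_lie A) (i (+) j).
Proof. by move=> aP uP; exact: vt_gr. Qed.

(** This is the derivation identity [V_der], rearranged. *)
Lemma theta_fun_brl i i' j a b u : a \in gr (lieA A) i ->
  b \in gr (lieA A) i' -> u \in gr (ideal_lie (@commA_ideal K A)) j ->
  theta_fun (br a b) u = theta_fun a (xm_act CX b u)
    - (-1) ^+ (i && i') *: theta_fun b (xm_act CX a u).
Proof.
move=> aP bP uP; apply/esym/eqP; rewrite subr_eq; apply/eqP.
exact: (V_der aP bP uP).
Qed.

(** The derivation identity again, with antisymmetry of [V(A)] and of the commutator bringing [u]
    and [w] to the second place; the signs agree for each choice of parities. *)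
Lemma theta_fun_brr i j j' a u w : a \in gr (lieA A) i ->
  u \in gr (ideal_lie (@commA_ideal K A)) j ->
  w \in gr (ideal_lie (@commA_ideal K A)) j' ->
  theta_fun a (br u w)
  = (-1) ^+ (j' && (i (+) j)) *: theta_fun (xm_back CX w a) u
    - (-1) ^+ (i && j) *: theta_fun (xm_back CX u a) w.
Proof.
move=> aP uP wP; rewrite /theta_fun.
have {}uP : sub_val u \in gr A j by [].
have {}wP : sub_val w \in gr A j' by [].
rewrite -[LHS]/(vt a (sbr (sub_val u) (sub_val w))).
rewrite -[xm_back CX w a]/(sbr (sub_val w) a) -[xm_back CX u a]/(sbr (sub_val u) a).
rewrite (V_der aP uP wP) (V_anti uP (sbr_gr aP wP)).
rewrite (sbr_anti aP uP) (sbr_anti aP wP).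
rewrite !(bilNl vB) !(bilZl vB).
by case: i j j' {aP uP wP} => [] [] [] /=;
  rewrite ?(expr0, expr1, scale1r, scaleN1r); abel.
Qed.

Lemma theta_fun_br i j i' j' a u b w : a \in gr (lieA A) i ->
  u \in gr (ideal_lie (@commA_ideal K A)) j -> b \in gr (lieA A) i' ->
  w \in gr (ideal_lie (@commA_ideal K A)) j' ->
  br (theta_fun a u) (theta_fun b w)
  = - ((-1) ^+ (i && j) *: theta_fun (xm_back CX u a) (xm_act CX b w)).
Proof.
move=> aP uP bP wP; have {}uP : sub_val u \in gr A j by [].
rewrite -[LHS]/(V_br (vt a (sub_val u)) (vt b (sub_val w))) V_br_vt.
by rewrite (sbr_anti aP uP) (bilNl vB) (bilZl vB).
Qed.

Definition theta : lie_hom (xm_tensor CX) VX :=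
  ntens_lift theta_fun_bilinear theta_fun_gr theta_fun_brl theta_fun_brr
    theta_fun_br.

Lemma theta_tens a u : theta (xm_tens a u) = vt a (sub_val u).
Proof. exact: ntens_liftE. Qed.

(** Elements of [[A,A]] are combinations of commutators, so the image of θ is spanned by the classes
    of [a ⊗ [b, d]]. *)
Lemma theta_ind (Q : V_super A -> Prop) :
    Q 0 -> (forall c a b d v, Q v -> Q (c *: vt a (sbr b d) + v)) ->
  forall y, Q (theta y).
Proof.
move=> Q0 QS; elim/xm_tensor_ind => [|c a u y Qy]; first by rewrite sh0.
rewrite (shD theta) (shZ theta) theta_tens.
(* The scalar and the remaining term are generalised, so that a combination in the second factor can
   be peeled off one summand at a time. *)
have := sub_valP u; move: (sub_val u) c (theta y : V_super A) Qy.
move=> x c v Qv xC; move: x xC c v Qv.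
apply: span_ind => [|_ [b d _ _]|e x x' _ _ Qx Qx'] c v Qv.
- by rewrite (bil0r vB) scaler0 add0r.
- exact: QS.
- rewrite (bilDr vB) (bilZr vB) scalerDr scalerA -addrA.
  by apply: (Qx (c * e)); exact: Qx'.
Qed.

(** On [a ⊗ v] both sides are the class of [a ⊗ μ(v)], by definition of the action on [V(A)]. *)
Lemma theta_tensor_comm z : theta (tensor_comm z) = xm_nu VX z.
Proof.
elim/xm_tensor_ind: z => [|c a v z IH]; first by rewrite !sh0.
rewrite (shD tensor_comm) (shZ tensor_comm) tensor_commE.
rewrite (shD theta) (shZ theta) theta_tens IH.
rewrite (shD (xm_nu VX)) (shZ (xm_nu VX)).
by rewrite xm_nu_tens.
Qed.

(** By surjectivity of [tensor_comm] it suffices to compare on its values, where the previous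
    triangle and the naturality of ν apply. *)
Lemma V_comm_theta y : V_comm_hom (theta y) = xm_nu CX y.
Proof.
have [z <-] := xm_tensor_map_surj V_comm_act V_comm_bd V_comm_surj y.
rewrite -/tensor_comm (theta_tensor_comm z).
exact/esym/(xm_nu_natural V_comm_act V_comm_bd).
Qed.

Lemma V_act0 a v : mu_hom A v = 0 -> xm_act VX a v = 0.
Proof. by move=> v0; rewrite /= /V_act_fun v0 (bil0r vB). Qed.

(** The map exists because [HC_1(A)] is acted on trivially, so commutators tensor to zero with it.
    The two factors are swapped during the construction since [bilinear_descent] acts on the second
    variable. *)
Lemma Acomm_tensor :
  exists f : superhom (tensor (Acomm A) (HC1 A)) (xm_tensor VX),
  forall a h, f (tens (sqpi (commA A) a) h) = xm_tens (X := VX) a (sub_val h).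
Proof.
have tB := xm_tens_bilinear VX.
have fB : bilinear_map (fun (h : HC1 A) (a : A) => xm_tens (X := VX) a (sub_val h)).
  apply: bilinear_mapI => [c h h' a|c h a a'].
    by rewrite -(bilZr tB) -(bilDr tB).
  by rewrite (bilDl tB) (bilZl tB).
have [||g [gB g_gr gE]] :=
    bilinear_descent (@sqpi_surj K A (commA A)) fB (P := xm_tensor VX).
- by move=> i j h a hP aP; rewrite addbC; exact: ntens_gr.
- move=> h a /sqpi0 aC; apply: xm_tens_comm0 aC => b.
  apply: V_act0; apply/V_comm_eq0; apply/kerP; exact: sub_valP.
have g_gr' i j q h : q \in gr (Acomm A) i -> h \in gr (HC1 A) j ->
  g h q \in gr (xm_tensor VX) (i (+) j) by move=> qP hP; rewrite addbC; exact: g_gr.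
exists (stens_lift (bilinear_flip gB) g_gr') => a h.
by rewrite stens_liftE gE.
Qed.

Lemma V_sub_Milnor x : x \in V_sub A -> sqpi (Milnor_sub A) x = 0.
Proof.
move=> xV; apply/sqpi0; move: x xV; apply: span_sub => x xR.
exact/span_gen/Milnor_rel_V.
Qed.

Definition V_Milnor : superhom (V_super A) (HC1M A) := sqlift V_sub_Milnor.

Lemma V_Milnor_surj y : exists v, V_Milnor v = y.
Proof.
have [t <-] := sqpi_surj y; exists (sqpi (V_sub A) t).
exact: (sqliftE V_sub_Milnor).
Qed.

(** For homogeneous elements this is the additional Milnor relation, its two terms being gathered
    into [a ⊗ [b, c]]. *)
Lemma V_Milnor_comm a b c : V_Milnor (vt a (sbr b c)) = 0.
Proof.
elim/homog_ind: a => [a a'|i a aP]; first by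
  rewrite (bilDl vB) shD => -> ->; rewrite addr0.
elim/homog_ind: b => [b b'|j b bP]; first by
  rewrite (bilDl sB) (bilDr vB) shD => -> ->; rewrite addr0.
elim/homog_ind: c => [c c'|k c cP]; first by
  rewrite (bilDr sB) (bilDr vB) shD => -> ->; rewrite addr0.
rewrite (sbrE bP cP) /vt.
transitivity (sqpi (Milnor_sub A) (tens a (smul b c - (-1) ^+ (j && k) *: smul c b))).
  exact: (sqliftE V_sub_Milnor).
have tB := @tens_bilinear K A A.
apply/sqpi0; rewrite (bilBr tB) (bilZr tB).
exact/span_gen/(Milnor_rel_comm aP bP cP).
Qed.

(** The relations that [HC_1^M(A)] adds to those of [V(A)] are the elements [a ⊗ [b, c]], which are
    values of θ and span its image. *)
Lemma V_Milnor_eq0 v : V_Milnor v = 0 <-> exists y, theta y = v.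
Proof.
split; last first.
  move=> [y <-].
  apply: (theta_ind (Q := fun w => V_Milnor w = 0)) => [|c a b d w w0].
    exact: sh0.
  by rewrite shD shZ V_Milnor_comm w0 scaler0 addr0.
have [t <-] := sqpi_surj v; rewrite (sqliftE V_sub_Milnor) => /sqpi0.
move: t {v}; apply: span_ind => [|t tR|c x y _ _ [y1 E1] [y2 E2]].
- by exists 0; rewrite !sh0.
- case: tR => {t} [t tR|i j k a b c aP bP cP].
    exists 0; rewrite sh0; apply/esym/sqpi0; exact: span_gen.
  have bcC : sbr b c \in commA A by exact: brspanP.
  exists (xm_tens (X := CX) a (exist (fun u => u \in commA A) _ bcC)).
  rewrite theta_tens -[sub_val _]/(sbr b c) (sbrE bP cP).
  by rewrite (bilBr vB) (bilZr vB) shB shZ.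
- by exists (c *: y1 + y2); rewrite (shD theta) (shZ theta) E1 E2 (shD (sqpi _)) (shZ (sqpi _)).
Qed.

Local Notation commAA :=
  (gpreim (sub_incl (commA A)) (brspan (gfull (lieA A)) (commA A))).

Definition AA_comm_quot : superhom (tensor A A) (comm_quot A) :=
  shcomp (sqpi commAA) (shcomp (V_comm A) (sqpi (V_sub A))).

(** The relations of [V(A)] vanish already there, and the additional one goes to [[a, [b, c]]],
    which lies in [[A, [A, A]]]. *)
Lemma AA_comm_quot_rel x : x \in Milnor_sub A -> AA_comm_quot x = 0.
Proof.
have tB := @tens_bilinear K A A.
move: x; apply: span_ind => [|t tR|c x y _ _ x0 y0]; first exact: sh0.
  case: tR => {t} [t tR|i j k a b c aP bP cP].
    have t0 : sqpi (V_sub A) t = 0 by apply/sqpi0/span_gen.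
    transitivity (sqpi commAA (V_comm A (sqpi (V_sub A) t))) => //.
    by rewrite t0 !sh0.
  rewrite -(bilZr tB) -(bilBr tB) -(sbrE bP cP).
  apply/sqpi0; rewrite -[_ \in _]/(mu_hom A (vt a (sbr b c)) \in _) mu_vt.
  by apply: brspanP => //; exact: brspanP.
by rewrite shD shZ x0 y0 scaler0 addr0.
Qed.

Definition Milnor_comm_quot : superhom (HC1M A) (comm_quot A) :=
  sqlift AA_comm_quot_rel.

Lemma Milnor_comm_quotE v :
  Milnor_comm_quot (V_Milnor v) = sqpi commAA (V_comm A v).
Proof.
have [t <-] := sqpi_surj v; rewrite (sqliftE V_sub_Milnor).
exact: (sqliftE AA_comm_quot_rel).
Qed.

(** A spanning element [[a, u]] is μ of the class of [a ⊗ u], a value of θ. *)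
Lemma commAA_theta x : x \in brspan (gfull (lieA A)) (commA A) ->
  exists2 v, exists y, theta y = v & mu_hom A v = x.
Proof.
move: x; apply: span_ind => [|_ [a u _ uC]|c x y _ _ [v [y1 E1] <-] [w [y2 E2] <-]].
- by exists 0; [exists 0; rewrite sh0 | rewrite sh0].
- exists (vt a u); last exact: mu_vt.
  exists (xm_tens (X := CX) a (exist (fun u => u \in commA A) _ uC)).
  exact: theta_tens.
- exists (c *: v + w); last by rewrite shD shZ.
  by exists (c *: y1 + y2); rewrite (shD theta) (shZ theta) E1 E2.
Qed.
End CyclicSequence.

(** * Exactness at each term *)

Theorem theorem5p9 (K : comPzRingType) (A : superalgebra K) :
  exists (f1 : superhom (tensor (Acomm A) (HC1 A)) (H1 (V_xmod A)))
         (f2 : superhom (H1 (V_xmod A)) (H1 (comm_xmod A)))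
         (f3 : superhom (H1 (comm_xmod A)) (HC1 A))
         (f4 : superhom (HC1 A) (HC1M A))
         (f5 : superhom (HC1M A) (comm_quot A)),
    [/\ exact_at f1 f2, exact_at f2 f3, exact_at f3 f4, exact_at f4 f5
      & forall z : comm_quot A, exists y : HC1M A, f5 y = z].
Proof.
have [F FE] := Acomm_tensor A.
have HC1_mu (h : HC1 A) : mu_hom A (sub_val h) = 0.
  by apply/V_comm_eq0; apply/kerP; exact: sub_valP.
have F_nu x : xm_nu (V_xmod A) (F x) = 0.
  elim/tens_ind: x => [|c q h x IH]; first by rewrite !sh0.
  have [a <-] := sqpi_surj q; rewrite (shD F) (shZ F) FE.
  rewrite (shD (xm_nu _)) (shZ (xm_nu _)) IH xm_nu_tens.
  by rewrite V_act0 ?scaler0 ?addr0.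
have F_ker x : F x \in ker (xm_nu (V_xmod A)) by apply/kerP.
have g_ker (z : H1 (V_xmod A)) :
    shcomp (@tensor_comm K A) (sub_incl _) z \in ker (xm_nu (comm_xmod A)).
  apply/kerP; rewrite -[shcomp _ _ z]/(tensor_comm A (sub_val z)).
  rewrite (xm_nu_natural (@V_comm_act K A) (@V_comm_bd K A)).
  by have /kerP -> := sub_valP z; exact: sh0.
have th_ker (y : H1 (comm_xmod A)) :
    shcomp (@theta K A) (sub_incl _) y \in ker (V_comm A).
  apply/kerP; rewrite -[shcomp _ _ y]/(theta A (sub_val y)).
  by have /kerP <- := sub_valP y; exact: V_comm_theta.
exists (corestr F_ker), (corestr g_ker), (corestr th_ker),
  (shcomp (V_Milnor A) (sub_incl _)), (Milnor_comm_quot A); split.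
- move=> z; split=> [/(congr1 (@sub_val _ _ _)) z0 | [x <-]].
    (* Right exactness with [S] the image of [F]: it contains every [a ⊗ v] with [v] in [HC_1(A)]
       and is killed by ν. *)
    have /imP [x xE] : sub_val z \in im F.
      apply: (xm_tensor_map_ker (f_act := @V_comm_act K A)
        (f_bd := @V_comm_bd K A) (@V_comm_surj K A) (S := im F)) z0.
      - move=> a v /kerP v0; apply/imP.
        pose h : HC1 A := exist (fun u => u \in ker (V_comm A)) v v0.
        exists (tens (sqpi (commA A) a) h).
        exact: FE.
      - by move=> _ /imP [x <-]; exact: F_nu.
    by exists x; exact: sub_val_inj.
  apply: sub_val_inj; rewrite -[LHS]/(tensor_comm A (F x)).
  elim/tens_ind: x => [|c q h x IH].
    by rewrite (sh0 F); exact: (sh0 (tensor_comm A)).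
  have [a <-] := sqpi_surj q; rewrite (shD F) (shZ F) FE.
  rewrite (shD (tensor_comm A)) (shZ (tensor_comm A)) IH tensor_commE.
  have -> : V_comm_hom A (sub_val h) = 0 by apply/V_comm_eq0; exact: HC1_mu.
  by rewrite (bil0r (xm_tens_bilinear _)) scaler0; exact: addr0.
- move=> y; split=> [/(congr1 (@sub_val _ _ _)) y0 | [z <-]].
    (* Any lift of [y] to [A ⊗ V(A)] lies in the kernel of ν, since ν factors through θ and θ kills
       [y]. *)
    have [z zE] := xm_tensor_map_surj (@V_comm_act K A) (@V_comm_bd K A)
      (@V_comm_surj K A) (sub_val y).
    have zK : z \in ker (xm_nu (V_xmod A)).
      by apply/kerP; rewrite -theta_tensor_comm /tensor_comm zE.
    exists (exist (fun u => u \in ker (xm_nu (V_xmod A))) z zK).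
    exact: sub_val_inj.
  apply: sub_val_inj; rewrite -[LHS]/(theta A (tensor_comm A (sub_val z))).
  by rewrite theta_tensor_comm; have /kerP := sub_valP z.
- move=> h; split=> [/V_Milnor_eq0 [y yE] | [y <-]]; last first.
    by apply/V_Milnor_eq0; exists (sub_val y).
  (* ν of [y] is the image in [[A,A]] of [θ(y) = h], which vanishes because [h] lies in
     [HC_1(A)]. *)
  have yK : y \in ker (xm_nu (comm_xmod A)).
    by apply/kerP; rewrite -V_comm_theta yE; exact/V_comm_eq0/HC1_mu.
  exists (exist (fun u => u \in ker (xm_nu (comm_xmod A))) y yK).
  exact: sub_val_inj.
- move=> y; split=> [|[h <-]]; last first.
    rewrite -[shcomp _ _ h]/(V_Milnor A (sub_val h)) Milnor_comm_quotE.
    by have /kerP -> := sub_valP h; exact: sh0.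
  have [v <-] := V_Milnor_surj y; rewrite Milnor_comm_quotE => /sqpi0 vC.
  (* Subtracting from [v] an element [w] of the image of θ with the same commutator gives an element
     of [HC_1(A)] with the same class in [HC_1^M(A)]. *)
  have [w wth wE] := commAA_theta vC.
  have vwK : v - w \in ker (V_comm A).
    by apply/kerP/V_comm_eq0; rewrite shB wE; exact: subrr.
  exists (exist (fun u => u \in ker (V_comm A)) (v - w) vwK).
  rewrite -[LHS]/(V_Milnor A (v - w)) shB.
  by have /V_Milnor_eq0 -> := wth; rewrite subr0.
- move=> z; have [u <-] := sqpi_surj z; have [v <-] := V_comm_surj u.
  by exists (V_Milnor A v); exact: Milnor_comm_quotE.
Qed.
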